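(* In the setting given in the context (reference Gaussian $\mu_0=N(m_0,C_0)$, target $\mu$ with $d\mu/d\mu_0=Z_\mu^{-1}e^{-\Phi_\mu}$, Cameron-Martin space $\mathcal{H}^1$, functional $J$, and maps $f,F$), assume: (i) There exists a Gaussian $\nu=N(m,C_0)$, equivalent to $\mu_0$, such that $\nu\ll\mu$. (ii) $\Phi_\mu'$ and $\Phi_\mu''$ exist for all $u\in\mathcal{H}^1$. (iii) There exists $m_\star$, a local minimizer of $J$, such that $J'(m_\star)=0$. (iv) The mapping $m\mapsto\mathbb{E}^{\nu_0}\big[\|\sqrt{C_0}\,\Phi_\mu'(m+v)\|^2\big]$ is bounded on bounded subsets of $\mathcal{H}^1$. (v) There exist a convex neighborhood $U_\star$ of $m_\star$ in $\mathcal{H}^1$ and a constant $\alpha>0$ such that for all $m\in U_\star$ and all $u\in\mathcal{H}^1$, $\langle J''(m)u,u\rangle\ge\alpha\|u\|_{\mathcal{H}^1}^2$. Let $(a_n)$ satisfy $a_n>0$, $\sum_n a_n=\infty$, $\sum_n a_n^2<\infty$, and let $X_n$ denote the iterates of the truncated Robbins-Monro algorithm on the Hilbert space $\mathcal{H}^1$ with this $F$ and with i.i.d. samples $v_n\sim\nu_0$ (see context). Then: (a) If $U_\star$ can be taken to be all of $\mathcal{H}^1$, then for the expanding trust region algorithm, $X_n\to m_\star$ almost surely in $\mathcal{H}^1$. (b) If $U_\star$ is not all of $\mathcal{H}^1$, then, taking $U_1$ to be a bounded (in $\mathcal{H}^1$) convex subset of $U_\star$ with $m_\star\in U_1$, and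 $U_0$ any subset of $U_1$ such that there exist $R_0<R_1$ with $U_0\subset B_{R_0}(m_\star)\subset B_{R_1}(m_\star)\subset U_1$, for the fixed trust region algorithm with these $U_0,U_1$, $X_n\to m_\star$ almost surely in $\mathcal{H}^1$.
   Context: $(\mathcal{H},\langle\cdot,\cdot\rangle,\|\cdot\|)$ is a separable Hilbert space; $\mu_0=N(m_0,C_0)$ is a Gaussian measure on $\mathcal{H}$; $\mu\ll\mu_0$ is a probability measure on the Borel sets of $\mathcal{H}$ with $\frac{d\mu}{d\mu_0}(u)=\frac1{Z_\mu}\exp\{-\Phi_\mu(u)\}$, where $\Phi_\mu:X\to\mathbb{R}$ is continuous, $X$ is a Banach space which is a subspace of $\mathcal{H}$ of full $\mu_0$-measure, and $Z_\mu=\mathbb{E}^{\mu_0}[e^{-\Phi_\mu}]\in(0,\infty)$. The Cameron-Martin space $\mathcal{H}^1$ is the Hilbert space with inner product $\langle f,g\rangle_{\mathcal{H}^1}=\langle C_0^{-1/2}f,C_0^{-1/2}g\rangle$ and norm $\|f\|_{\mathcal{H}^1}=\langle f,f\rangle_{\mathcal{H}^1}^{1/2}$; $m_0\in\mathcal{H}^1$. Below, $B_r(x)$ denotes the open ball in $\mathcal{H}^1$, and means $m$ range over $\mathcal{H}^1$. Let $\nu_0=N(0,C_0)$ and $v\sim\nu_0$. For $m\in\mathcal{H}^1$ define the relative entropy functional $$J(m)=\mathcal{R}(N(m,C_0)\|\mu)=\mathbb{E}^{\nu_0}[\Phi_\mu(v+m)]+\tfrac12\|m-m_0\|_{\mathcal{H}^1}^2+\log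 Z_\mu,$$ where $\mathcal{R}(\nu\|\mu)=\mathbb{E}^\nu[\log\frac{d\nu}{d\mu}]$ if $\nu\ll\mu$ and $+\infty$ otherwise. Primes denote variational derivatives taken with respect to the $\mathcal{H}$ inner product (first derivative a gradient, second derivative an operator); the first and second variations of $J$ are $$J'(m)=\mathbb{E}^{\nu_0}[\Phi_\mu'(v+m)]+C_0^{-1}(m-m_0),\qquad J''(m)=\mathbb{E}^{\nu_0}[\Phi_\mu''(v+m)]+C_0^{-1},$$ where it is a standing convention that these expressions make sense (with $\Phi_\mu'(v+m),\Phi_\mu''(v+m)$ defined for $\nu_0$-a.e. $v$) and are the first and second variations of $J$; $\langle J''(m)u,u\rangle$ is the associated quadratic form on $\mathcal{H}^1$. Define $$f(m)=C_0\mathbb{E}^{\nu_0}[\Phi_\mu'(v+m)]+(m-m_0),\qquad F(m,v)=C_0\Phi_\mu'(v+m)+(m-m_0),$$ so $f(m)=\mathbb{E}^{\nu_0}[F(m,v)]=C_0J'(m)$. Truncated Robbins-Monro algorithms on $\mathcal{H}^1$: let $v_1,v_2,\dots$ be i.i.d. with law $\nu_0$, let $X_0\in U_0$ be an initial point (independent of $(v_n)$ if random), $\sigma_0=0$, and for $n\ge0$ put $\tilde X_{n+1}=X_n-a_{n+1}F(X_n,v_{n+1})$. - Fixed trust region: $U_0\subsetneq U_1$ are open bounded subsets of $\mathcal{H}^1$. If $\tilde X_{n+1}\in U_1$ then $X_{n+1}=\tilde X_{n+1}$, $\sigma_{n+1}=\sigma_n$; otherwise $X_{n+1}=X_0^{(\sigma_n)}$,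 $\sigma_{n+1}=\sigma_n+1$. - Expanding trust region: $U_n=B_{r_n}(0)\subset\mathcal{H}^1$ with $0<r_0<r_1<\cdots$, $r_n\to\infty$. If $\tilde X_{n+1}\in U_{\sigma_n}$ then $X_{n+1}=\tilde X_{n+1}$, $\sigma_{n+1}=\sigma_n$; otherwise $X_{n+1}=X_0^{(\sigma_n)}$, $\sigma_{n+1}=\sigma_n+1$. In both cases the restart points $X_0^{(\sigma_n)}$ lie in $U_0$ and may be fixed or random, subject to $X_n$ being measurable with respect to $\sigma(X_0,v_1,\dots,v_n)$ for every $n$. *)

(* Defs.v *)
From HB Require Import structures.
From mathcomp Require Import all_boot all_order all_algebra.
From mathcomp Require Import all_classical all_reals all_analysis.
Import Order.TTheory GRing.Theory Num.Theory.
Import numFieldNormedType.Exports.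

Set Implicit Arguments.
Unset Strict Implicit.
Unset Printing Implicit Defensive.

Local Open Scope classical_set_scope.
Local Open Scope ring_scope.
Local Open Scope charge_scope.

Definition separable (T : topologicalType) : Prop :=
  exists D : set T, countable D /\ dense D.

Definition borel (T : ptopologicalType) := g_sigma_algebraType (@open T).

Definition gateaux (R : realType) (H : completeNormedModType R)
    (G : H -> R) (u h : H) (l : R) : Prop :=
  is_derive (0 : R) (1 : R) (fun t : R => G (u + t *: h)) l.

Section hilbert.
Context (R : realType) (H : completeNormedModType R) (ip : {dot H for idfun}).

(* With completeness of H, this makes (H, ip) a real Hilbert space. *)
Definition norm_from_ip : Prop := forall x : H, `|x| = Num.sqrt (ip x x).

(* The positive square root of a bounded positive operator is unique, so this
   pins down S = C^(1/2). *)
Definition is_sqrt_op (C S : {linear H -> H}) : Prop :=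
  [/\ continuous (S : H -> H),
      forall x y, ip (S x) y = ip x (S y),
      forall x, 0 <= ip (S x) x &
      forall x, S (S x) = C x].

(* nu = N(m, C): every <., h> has law N(<m, h>, <C h, h>) under nu.
   normal_prob takes the standard deviation, and normal_prob _ 0 is not a Dirac
   mass in the library, hence the case split. *)
Definition is_gaussian (m : H) (C : {linear H -> H})
    (nu : probability (borel H) R) : Prop :=
  forall (h : H) (A : set R), measurable A ->
    nu ((fun u => ip u h) @^-1` A) =
    if ip (C h) h == 0 then \d_(ip m h) A
    else normal_prob (ip m h) (Num.sqrt (ip (C h) h)) A.

Section cameron_martin.
Variable S : {linear H -> H}.

Definition cm_space : set H := range (S : H -> H).

(* S^-1 on the range of S; when S has a kernel, the preimage orthogonal to the
   kernel is selected. *)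
Definition inv_sqrt (f : H) : H :=
  get [set g : H | S g = f /\ forall k, S k = 0 -> ip g k = 0].

Definition cm_ip (f g : H) : R := ip (inv_sqrt f) (inv_sqrt g).

Definition cm_norm (f : H) : R := Num.sqrt (cm_ip f f).

Definition cm_ball (x : H) (r : R) : set H :=
  [set y | cm_space y /\ cm_norm (y - x) < r].

Definition cm_open (U : set H) : Prop :=
  U `<=` cm_space /\
  forall x, U x -> exists2 r : R, 0 < r & cm_ball x r `<=` U.

Definition cm_bounded (U : set H) : Prop :=
  U `<=` cm_space /\ exists r : R, forall x, U x -> cm_norm x <= r.

Definition cm_nbhs (x : H) (U : set H) : Prop :=
  U `<=` cm_space /\ exists2 r : R, 0 < r & cm_ball x r `<=` U.

End cameron_martin.

Section potential.
Variables (X : completeNormedModType R) (iota : {linear X -> H}).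

(* Phi seen as a function on H through the embedding iota; its values off the
   range of iota are irrelevant (the range has full measure). *)
Definition extend (Phi : X -> R) (u : H) : R :=
  Phi (get [set x | iota x = u]).

Variables (S : {linear H -> H}) (Phi : X -> R).

(* Variations are taken in the Cameron-Martin directions and represented through
   the inner product of H. *)
Definition is_gradient (u g : H) : Prop :=
  range (iota : X -> H) u /\
  forall h, cm_space S h -> gateaux (extend Phi) u h (ip g h).

(* A is the derivative at u of the gradient field dPhi of Phi. *)
Definition is_hessian (dPhi : H -> H) (u : H) (A : H -> H) : Prop :=
  forall h, cm_space S h ->
    (\forall t \near (0 : R), is_gradient (u + t *: h) (dPhi (u + t *: h))) /\
    forall k, cm_space S k ->
      gateaux (fun w => ip (dPhi w) k) u h (ip (A h) k).

End potential.

End hilbert.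

Definition relative_entropy d (T : measurableType d) (R : realType)
    (nu mu : probability T R) : \bar R :=
  if `[< nu `<< mu >]
  then (\int[nu]_x lne (('d (charge_of_finite_measure nu) '/d mu) x))%E
  else +oo%E.

Section functional.
Context (R : realType) (H : completeNormedModType R) (ip : {dot H for idfun}).
Variables (C0 S : {linear H -> H}) (nu0 : probability (borel H) R) (m0 : H).
Variables (dPhi : H -> H) (d2Phi : H -> {linear H -> H}).

(* <J'(m), h> and <J''(m) u, w>, the terms in C0^-1 being read as
   <C0^-1 f, h> = <C0^(-1/2) f, C0^(-1/2) h> = cm_ip f h.  In general C0^-1 f
   belongs to the dual of the Cameron-Martin space and not to H. *)
Definition J' (m h : H) : R :=
  Rintegral nu0 setT (fun v : borel H => ip (dPhi ((v : H) + m)) h)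
  + cm_ip ip S (m - m0) h.

Definition J'' (m u w : H) : R :=
  Rintegral nu0 setT (fun v : borel H => ip (d2Phi ((v : H) + m) u) w)
  + cm_ip ip S u w.

(* The expressions J' and J'' make sense and are the first and second variations
   of J on the Cameron-Martin space. *)
Definition variations_of (J : H -> \bar R) : Prop :=
  forall m, cm_space S m ->
  [/\ J m \is a fin_num,
      forall h, cm_space S h ->
        nu0.-integrable setT
          (fun v : borel H => (ip (dPhi ((v : H) + m)) h)%:E),
      forall u w, cm_space S u -> cm_space S w ->
        nu0.-integrable setT
          (fun v : borel H => (ip (d2Phi ((v : H) + m) u) w)%:E),
      forall h, cm_space S h -> gateaux (fun m' => fine (J m')) m h (J' m h) &
      forall u w, cm_space S u -> cm_space S w ->
        gateaux (fun m' => J' m' w) m u (J'' m u w)].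

Definition F (m v : H) : H := C0 (dPhi (v + m)) + (m - m0).

End functional.

Section robbins_monro.
Context (R : realType) (H : completeNormedModType R) (ip : {dot H for idfun}).
Context d (Omega : measurableType d) (P : probability Omega R).

(* Mutual independence of a sequence of H-valued random variables; a finite
   subfamily is obtained by taking B i = setT for the other indices. *)
Definition independent_seq (Y : nat -> Omega -> H) : Prop :=
  forall (n : nat) (B : nat -> set (borel H)), (forall i, measurable (B i)) ->
    P (\bigcap_(i < n) (Y i @^-1` B i)) = (\prod_(i < n) P (Y i @^-1` B i))%E.

Definition history (X0 : Omega -> H) (v : nat -> Omega -> H) (n : nat) :
    set (set Omega) :=
  <<s [set E | exists2 B : set (borel H), measurable B &
         E = X0 @^-1` B \/ exists2 i, (i < n)%N & E = v i @^-1` B] >>.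

(* a n and v n stand for the step size a_(n+1) and the sample v_(n+1);
   restart k is the restart point X_0^(k). *)
Definition truncated_RM (S : {linear H -> H}) (nu0 : probability (borel H) R)
    (G : H -> H -> H) (a : nat -> R) (U0 : set H) (trunc : nat -> set H)
    (v : nat -> Omega -> H) (X : nat -> Omega -> H)
    (sigma : nat -> Omega -> nat) (restart : nat -> Omega -> H) : Prop :=
  [/\ measurable_fun setT (X 0%N : Omega -> borel H) /\
        (forall n, measurable_fun setT (v n : Omega -> borel H)),
      (forall n (A : set (borel H)), measurable A -> P (v n @^-1` A) = nu0 A) /\
        independent_seq (fun n => if n is k.+1 then v k else X 0%N),
      (forall w, U0 (X 0%N w)) /\ (forall k w, U0 (restart k w)),
      (forall w, sigma 0%N w = 0%N) /\
      (forall n w,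
        let Xt := X n w - a n *: G (X n w) (v n w) in
        (trunc (sigma n w) Xt ->
           X n.+1 w = Xt /\ sigma n.+1 w = sigma n w) /\
        (~ trunc (sigma n w) Xt ->
           X n.+1 w = restart (sigma n w) w /\
           sigma n.+1 w = (sigma n w).+1)) &
      forall n (B : set (borel H)), measurable B ->
        history (X 0%N) v n (X n @^-1` B)].

Definition fixed_trust_region S nu0 G a (U0 U1 : set H) v X sigma restart :=
  [/\ cm_open ip S U0 /\ cm_open ip S U1,
      cm_bounded ip S U0 /\ cm_bounded ip S U1,
      U0 `<` U1 &
      truncated_RM S nu0 G a U0 (fun=> U1) v X sigma restart].

Definition expanding_trust_region S nu0 G a (r : nat -> R) v X sigma restart :=
  [/\ 0 < r 0%N, (forall n, r n < r n.+1), r @ \oo --> +oo &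
      truncated_RM S nu0 G a (cm_ball ip S 0 (r 0%N))
        (fun n => cm_ball ip S 0 (r n)) v X sigma restart].

Definition cm_converges_as S (X : nat -> Omega -> H) (x : H) : Prop :=
  {ae P, forall w, (fun n => cm_norm ip S (X n w - x)) @ \oo --> (0 : R)}.

End robbins_monro.

(* Main.v *)
(* Let T = C0^(-1/2) and D_n = |T (X_n - mstar)|^2.  As <f, C0 g> computed in the
   Cameron-Martin space is <f, g> in H, a step that is not truncated gives
     D_(n+1) = D_n - 2 a_n (J'(X_n)(X_n - mstar) + xi_n) + a_n^2 |T F(X_n, v_n)|^2
   with martingale differences xi_n, and strong convexity bounds
   J'(X_n)(X_n - mstar) from below by alpha D_n.  Cut off to {D_n <= K}, the noise
   has bounded second moments by (iv), so that the series of a_n xi_n (an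
   L^2-bounded martingale) and of a_n^2 |T F|^2 converge almost surely for all
   integers K.  A convergent perturbation cannot carry D_n infinitely often from
   the restart region to the truncation boundary, so there are finitely many
   truncations; after the last one D_n converges, and its limit is 0 because the
   a_n are not summable. *)

Require Import Defs.
From HB Require Import structures.
From mathcomp Require Import all_boot all_order all_algebra.
From mathcomp Require Import all_classical all_reals all_analysis.
From mathcomp Require Import measurable_realfun.
From mathcomp Require Import ring lra zify.
Import Order.TTheory GRing.Theory Num.Theory.
Import numFieldNormedType.Exports.

Local Open Scope classical_set_scope.
Local Open Scope ring_scope.
Local Open Scope charge_scope.

Set Implicit Arguments.
Unset Strict Implicit.

(** Once the noise series converge, each path is treated deterministically; probability only
    supplies a null set. The obstacle before that is that iterates are Borel in [H], while the norm
    driving the argument uses [inv_sqrt], an inverse defined by choice on a range that is in general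
    not closed. Two facts get round it. The random part of a step is [C0 g], and C0^(-1/2) C0 g = S
    g depends continuously on g. Moreover |T f|^2 <= K amounts to <f, h>^2 <= K |S h|^2 for all h,
    which cuts out a closed set of [H]. So the cut-off noise is jointly measurable in iterate and
    sample. No conditional expectation is formed: past and fresh sample have a product law, and
    Fubini integrates the sample out. In the expanding case the final trust region, hence the
    cutoff, depends on the path, which is why countably many cutoffs are handled on one null set.
    There the boundary is far from [mstar] only after many truncations, so their finiteness is
    proved by contradiction: infinitely many would drive the radius to infinity. *)

(** * Cauchy-Schwarz and orthogonal projection *)

Section inner_product.
Context {R : realType} {H : completeNormedModType R} {ip : {dot H for idfun}}.
Hypothesis hip : norm_from_ip ip.

Lemma ipC x y : ip x y = ip y x.
Proof. by rewrite (hermC ip x y) expr0 mul1r. Qed.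

Lemma ipDl x y z : ip (x + y) z = ip x z + ip y z.
Proof. exact: linearDl. Qed.

Lemma ipDr x y z : ip x (y + z) = ip x y + ip x z.
Proof. exact: linearDr. Qed.

Lemma ipNl x z : ip (- x) z = - ip x z.
Proof. exact: linearNl. Qed.

Lemma ipNr x z : ip x (- z) = - ip x z.
Proof. exact: linearNr. Qed.

Lemma ipZl a x z : ip (a *: x) z = a * ip x z.
Proof. exact: linearZl_LR. Qed.

Lemma ipZr a x z : ip x (a *: z) = a * ip x z.
Proof. exact: linearZr_LR. Qed.

Definition ipE := (ipDl, ipDr, ipNl, ipNr, ipZl, ipZr).

Lemma ip_ge0 x : 0 <= ip x x.
Proof.
have [->|x0] := eqVneq x 0; first by rewrite linear0l.
exact/ltW/neq0_dnorm_gt0.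
Qed.

Lemma ip_norm x : ip x x = `|x| ^+ 2.
Proof. by rewrite hip sqr_sqrtr// ip_ge0. Qed.

Lemma ip_norm_le x y : `|ip x y| <= `|x| * `|y|.
Proof.
have [->|y0] := eqVneq y 0; first by rewrite linear0r !normr0 mulr0.
have ny : 0 < `|y| by rewrite normr_gt0.
rewrite -(@ler_pXn2r _ 2)// ?nnegrE// ?mulr_ge0// real_normK ?num_real//.
(* The component of [x] orthogonal to [y], scaled by |y|^2 to avoid a division. *)
have := ip_ge0 (`|y| ^+ 2 *: x - ip x y *: y).
rewrite !ipE (ipC y x) !ip_norm => h.
have : 0 <= `|y| ^+ 2 * (`|x| ^+ 2 * `|y| ^+ 2 - ip x y ^+ 2).
  by apply: le_trans h _; rewrite le_eqVlt; apply/orP; left; apply/eqP; ring.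
by rewrite pmulr_rge0 ?exprn_gt0// subr_ge0 exprMn.
Qed.

Lemma continuous_ipl h : continuous (fun x : H => ip x h).
Proof.
move=> x; apply/cvgrPdist_lt => e e0.
have h0 : 0 < `|h| + 1 by rewrite ltr_wpDl.
have : \forall y \near x, `|x - y| < e / (`|h| + 1).
  by apply: cvgr_dist_lt; [exact: cvg_id|exact: divr_gt0].
apply: filterS => y; rewrite ltr_pdivlMr// => xy.
rewrite -ipNl -ipDl; apply: le_lt_trans (ip_norm_le _ _) _.
by apply: le_lt_trans xy; rewrite ler_wpM2l// lerDl.
Qed.

Lemma parallelogram_mid (x y z : H) :
  `|y - z| ^+ 2 =
  2 * `|x - y| ^+ 2 + 2 * `|x - z| ^+ 2 - 4 * `|x - 2^-1 *: (y + z)| ^+ 2.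
Proof. by rewrite -!ip_norm !ipE (ipC y x) (ipC z x) (ipC z y); field. Qed.

(** [V] need not be closed (it will be the range of [S]), so the projection lands in its closure. A
    minimizing sequence for the distance is Cauchy by the parallelogram identity; perturbing it
    along [v] and passing to the limit forces orthogonality. *)
Lemma ex_orthogonal_projection (V : set H) (x : H) : V 0 ->
  (forall a u v, V u -> V v -> V (a *: u + v)) ->
  exists2 p, closure V p & forall v, V v -> ip (x - p) v = 0.
Proof.
move=> V0 VP.
have VZ a u : V u -> V (a *: u) by move=> Vu; rewrite -[_ *: _]addr0; exact: VP.
pose E : set R := [set `|x - v| ^+ 2 | v in V].
have Elb : has_lbound E by exists 0 => _ [v _ <-]; rewrite exprn_ge0.
have E0 : E !=set0 by exists (`|x - 0| ^+ 2); exists 0.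
have infE v : V v -> inf E <= `|x - v| ^+ 2 by move=> Vv; apply: ge_inf => //; exists v.
have /choice[w wP] : forall n : nat, exists v, V v /\ `|x - v| ^+ 2 < inf E + n.+1%:R^-1.
  move=> n; have [] := @inf_adherent _ E n.+1%:R^-1; first by rewrite invr_gt0.
    by split.
  by move=> _ [v Vv <-] h; exists v.
have wV n : V (w n) by have [] := wP n.
have wd n m : `|w n - w m| ^+ 2 <= 2 * n.+1%:R^-1 + 2 * m.+1%:R^-1.
  rewrite (parallelogram_mid x).
  have h1 := ltW (wP n).2; have h2 := ltW (wP m).2.
  have h3 : inf E <= `|x - 2^-1 *: (w n + w m)| ^+ 2.
    apply: infE; apply: VZ; rewrite -[w n]scale1r; exact: VP.
  move: h1 h2 h3; move: (_ ^+ 2) (_ ^+ 2) (_ ^+ 2) (_^-1) (_^-1) => q1 q2 q3 i1 i2.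
  lra.
have cw : cvgn w.
  apply: cauchy_cvg; apply: cauchy_exP => e e0.
  have e4 : 0 < e ^+ 2 / 4 by rewrite divr_gt0 ?exprn_gt0.
  have [N _ hN] := near_infty_natSinv_lt (PosNum e4).
  exists (w N); exists N => // n /= Nn.
  rewrite -ball_normE /=.
  rewrite -(@ltr_pXn2r _ 2)// ?nnegrE ?(ltW e0)//.
  apply: le_lt_trans (wd _ _) _.
  have /= := hN N (leqnn N); have /= := hN n Nn.
  move: (N.+1%:R^-1 : R) (n.+1%:R^-1 : R) => a b; lra.
exists (limn w).
  apply: (closed_cvg (closure V) (@closed_closure _ V) _ _ cw).
  by apply: nearW => n; exact: subset_closure.
move=> v Vv.
have key t : 2 * t * ip (x - limn w) v <= t ^+ 2 * `|v| ^+ 2.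
  have c1 : (fun n => 2 * t * ip (x - w n) v) @ \oo --> 2 * t * ip (x - limn w) v.
    apply: cvgM; first exact: cvg_cst.
    have c0 : (fun n => x - w n) @ \oo --> x - limn w by apply: cvgB => //; exact: cvg_cst.
    exact: (cvg_comp _ _ c0 (@continuous_ipl v _)).
  have c2 : (fun n => n.+1%:R^-1 + t ^+ 2 * `|v| ^+ 2) @ \oo --> 0 + t ^+ 2 * `|v| ^+ 2.
    by apply: cvgD; [exact: cvg_harmonic|exact: cvg_cst].
  rewrite add0r in c2.
  apply: ler_cvg_to c1 c2 _; apply: nearW => n.
  have h1 := ltW (wP n).2.
  have h2 : inf E <= `|x - (t *: v + w n)| ^+ 2 by apply: infE; exact: VP.
  have : `|x - (t *: v + w n)| ^+ 2 =
         `|x - w n| ^+ 2 - 2 * t * ip (x - w n) v + t ^+ 2 * `|v| ^+ 2.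
    by rewrite -!ip_norm !ipE (ipC v x) (ipC (w n) x) (ipC v (w n)); ring.
  move=> h3; rewrite {}h3 in h2.
  move: h1 h2; move: (`|_ - _| ^+ 2) (_^-1) => q i h1 h2; lra.
move: key; move: (ip _ v) (`|v| ^+ 2) (exprn_ge0 2 (normr_ge0 v)) => s q q0 key.
apply/eqP/negP => /negP s0.
(* The optimal choice would be s / q; the shift by 1 covers [v = 0] and still violates [key] unless
   s = 0. *)
have := key (s / (q + 1)).
have q1 : q + 1 > 0 by lra.
have s2 : 0 < s ^+ 2 by rewrite exprn_even_gt0.
rewrite -subr_ge0.
have -> : (s / (q + 1)) ^+ 2 * q - 2 * (s / (q + 1)) * s =
  - (s ^+ 2 * (q + 2) / (q + 1) ^+ 2).
  by field; lra.
rewrite oppr_ge0 leNgt divr_gt0//; last exact: exprn_gt0.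
by apply: mulr_gt0 => //; lra.
Qed.

End inner_product.

(** * The Cameron-Martin norm and its dual description *)

Section cameron_martin.
Context {R : realType} {H : completeNormedModType R} {ip : {dot H for idfun}}.
Context {C0 S : {linear H -> H}}.
Hypotheses (hip : norm_from_ip ip) (hS : is_sqrt_op ip C0 S).

Local Notation T := (inv_sqrt ip S).
Local Notation cm := (cm_space S).

Lemma sqrt_op_sym x y : ip (S x) y = ip x (S y).
Proof. by case: hS. Qed.

Lemma sqrt_op_sqr x : S (S x) = C0 x.
Proof. by case: hS. Qed.

Lemma sqrt_op_continuous : continuous S.
Proof. by case: hS. Qed.

Lemma cm_space0 : cm 0.
Proof. by exists 0 => //; rewrite linear0. Qed.

Lemma cm_spaceP a f g : cm f -> cm g -> cm (a *: f + g).
Proof. by move=> [x _ <-] [y _ <-]; exists (a *: x + y) => //; rewrite linearP. Qed.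

Lemma cm_spaceZ a f : cm f -> cm (a *: f).
Proof. by move=> cf; rewrite -[_ *: _]addr0; exact/cm_spaceP/cm_space0. Qed.

Lemma cm_spaceD f g : cm f -> cm g -> cm (f + g).
Proof. by rewrite -{2}[f]scale1r; exact: cm_spaceP. Qed.

Lemma cm_spaceB f g : cm f -> cm g -> cm (f - g).
Proof. by move=> cf cg; rewrite -scaleN1r addrC; exact: cm_spaceP. Qed.

(** Project any preimage [x] onto the closure of the range: |S (x - p)|^2 = <x - p, S (S (x - p))> =
    0, so [p] is again a preimage. The closure clause is kept because [cm_norm_leP] extends an
    inequality to this point by continuity. *)
Lemma ex_inv_sqrt f : cm f ->
  exists g, [/\ S g = f, closure cm g & forall k, S k = 0 -> ip g k = 0].
Proof.
move=> [x _ <-].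
have [p cp po] := ex_orthogonal_projection hip x cm_space0 cm_spaceP.
exists p; split => //.
  have : ip (S (x - p)) (S (x - p)) = 0.
    by rewrite sqrt_op_sym po//; exists (S (x - p)).
  rewrite (ip_norm hip) => /eqP; rewrite sqrf_eq0 normr_eq0 linearB subr_eq0.
  by move/eqP.
move=> k Sk.
have : closed [set g | ip g k = 0].
  apply: (@closed_comp _ _ (fun g : H => ip g k) [set 0]); last exact: closed_eq.
  by move=> g _; exact: (continuous_ipl hip).
move/closure_id => E; rewrite -/([set g | ip g k = 0] p) E.
apply: closureS cp => _ [y _ <-] /=.
by rewrite sqrt_op_sym Sk linear0r.
Qed.

Lemma inv_sqrtP f : cm f -> S (T f) = f /\ forall k, S k = 0 -> ip (T f) k = 0.
Proof.
move=> /ex_inv_sqrt[g [gf _ gk]].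
by apply: (@getPex _ [set g | S g = f /\ forall k, S k = 0 -> ip g k = 0]); exists g.
Qed.

Lemma inv_sqrtK f : cm f -> S (T f) = f.
Proof. by move=> /inv_sqrtP[]. Qed.

Lemma inv_sqrt_uniq f g : S g = f -> (forall k, S k = 0 -> ip g k = 0) -> T f = g.
Proof.
move=> Sg gk; have [|ST Tk] := @inv_sqrtP f; first by exists g.
have Sd : S (T f - g) = 0 by rewrite linearB ST Sg subrr.
have : ip (T f - g) (T f - g) = 0 by rewrite ipDl ipNl Tk// gk// subrr.
rewrite (ip_norm hip) => /eqP; rewrite sqrf_eq0 normr_eq0 subr_eq0.
by move/eqP.
Qed.

Lemma inv_sqrt_closure f : cm f -> closure cm (T f).
Proof. by move=> /ex_inv_sqrt[g [gf cg gk]]; rewrite (inv_sqrt_uniq gf). Qed.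

Lemma inv_sqrtPl a f g : cm f -> cm g -> T (a *: f + g) = a *: T f + T g.
Proof.
move=> /inv_sqrtP[Sf fk] /inv_sqrtP[Sg gk]; apply: inv_sqrt_uniq.
  by rewrite linearP Sf Sg.
by move=> k Sk; rewrite !ipE fk// gk// mulr0 addr0.
Qed.

Lemma inv_sqrtD f g : cm f -> cm g -> T (f + g) = T f + T g.
Proof. by move=> cf cg; rewrite -[f in LHS]scale1r inv_sqrtPl// scale1r. Qed.

Lemma inv_sqrtB f g : cm f -> cm g -> T (f - g) = T f - T g.
Proof.
by move=> cf cg; rewrite addrC -scaleN1r inv_sqrtPl// scaleN1r addrC.
Qed.

Lemma inv_sqrtZ a f : cm f -> T (a *: f) = a *: T f.
Proof.
move=> cf; rewrite -[X in T X]addr0 inv_sqrtPl//; last exact: cm_space0.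
by rewrite (@inv_sqrt_uniq 0 0) ?addr0 ?linear0// => k _; rewrite linear0l.
Qed.

Lemma cm_space_sqr g : cm (C0 g).
Proof. by rewrite -sqrt_op_sqr; exists (S g). Qed.

(** The range of the symmetric [S] is orthogonal to its kernel, so [S g] is the selected preimage.
    Hence [C0 g] has Cameron-Martin norm |S g|, the quantity bounded in (iv). *)
Lemma inv_sqrt_sqr g : T (C0 g) = S g.
Proof.
by apply: inv_sqrt_uniq (sqrt_op_sqr g) _ => k Sk; rewrite sqrt_op_sym Sk linear0r.
Qed.

Lemma cm_normE f : cm_norm ip S f = `|T f|.
Proof. by rewrite /cm_norm /cm_ip hip. Qed.

Lemma cm_normD_le f g : cm f -> cm g ->
  cm_norm ip S (f + g) <= cm_norm ip S f + cm_norm ip S g.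
Proof. by move=> cf cg; rewrite !cm_normE inv_sqrtD// ler_normD. Qed.

Lemma cm_normB_le f g : cm f -> cm g ->
  cm_norm ip S (f - g) <= cm_norm ip S f + cm_norm ip S g.
Proof. by move=> cf cg; rewrite !cm_normE inv_sqrtB// ler_normB. Qed.

Lemma ip_inv_sqrt f h : cm f -> ip (T f) (S h) = ip f h.
Proof. by move=> cf; rewrite -sqrt_op_sym inv_sqrtK. Qed.

(** Since <f, h> = <T f, S h>, one direction is Cauchy-Schwarz. Conversely T f is a limit of vectors
    S h, and testing with T f itself gives |T f|^4 <= K |T f|^2. *)
Lemma cm_norm_leP f K : cm f -> 0 <= K ->
  cm_norm ip S f ^+ 2 <= K <-> forall h, ip f h ^+ 2 <= K * `|S h| ^+ 2.
Proof.
move=> cf K0; rewrite cm_normE; split => [TK h|TK].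
  rewrite -ip_inv_sqrt// -real_normK ?num_real//.
  apply: le_trans (_ : (`|T f| * `|S h|) ^+ 2 <= _).
    by rewrite lerXn2r ?nnegrE ?mulr_ge0// ip_norm_le.
  by rewrite exprMn ler_wpM2r// exprn_ge0.
pose g := T f.
have : closed [set u : H | 0 <= K * `|u| ^+ 2 - ip u g ^+ 2].
  apply: (@closed_comp _ _ (fun u : H => K * `|u| ^+ 2 - ip u g ^+ 2) [set y | 0 <= y]);
    last exact: closed_ge.
  move=> u _; apply: cvgB.
    by apply: cvgM; [exact: cvg_cst|apply: cvgM; apply: cvg_norm; exact: cvg_id].
  by apply: cvgM; exact: (continuous_ipl hip).
move/closure_id => E.
have : [set u : H | 0 <= K * `|u| ^+ 2 - ip u g ^+ 2] g.
  rewrite E; apply: closureS (inv_sqrt_closure cf) => _ [h _ <-] /=.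
  by rewrite subr_ge0 ipC ip_inv_sqrt.
rewrite /= (ip_norm hip) -/g subr_ge0.
have [->|g0] := eqVneq g 0; first by rewrite normr0 expr0n.
by rewrite [_ ^+ 2 ^+ 2]expr2 ler_pM2r// exprn_gt0// normr_gt0.
Qed.

End cameron_martin.

(** * Pathwise recursions for the squared distance *)

Section recursive_inequalities.
Context {R : realType}.
Implicit Types D s a : nat -> R.

Lemma cvg_eventually_close s e : cvgn s -> 0 < e ->
  exists N, forall m n, (N <= m)%N -> (N <= n)%N -> s m - s n < e.
Proof.
move=> cs e0.
have e2 : 0 < e / 2 by rewrite divr_gt0.
have /cvgrPdist_lt/(_ _ e2)[N _ hN] := cs.
exists N => m n Nm Nn; have /= := hN _ Nm; have /= := hN _ Nn.
rewrite !ltr_norml => /andP[h1 h2] /andP[h3 h4]; lra.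
Qed.

(** Any reset late enough for the oscillation of [s] to be below [kappa - rho] is the last one:
    afterwards [D] stays below [kappa], and another reset would need [s] to grow by the whole gap.
    In the last hypothesis [D n + (s n.+1 - s n)] stands for a bound on the rejected trial step,
    which itself does not appear in [D]. *)
Lemma finitely_many_resets D s (reset : nat -> Prop) rho kappa n0 :
  rho < kappa -> cvgn s ->
  (forall n, reset n -> D n.+1 <= rho) ->
  (forall n, D n <= kappa -> ~ reset n -> D n.+1 <= D n + (s n.+1 - s n)) ->
  (forall n, (n0 <= n)%N -> D n <= kappa -> reset n ->
     kappa <= D n + (s n.+1 - s n)) ->
  exists N, forall n, (N <= n)%N -> ~ reset n.
Proof.
move=> rk cs Dreset Dstep Dexit.
have [|n1 hn1] := cvg_eventually_close cs (_ : 0 < kappa - rho); first by rewrite subr_gt0.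
apply: contrapT => infinite.
have [n [n0n n1n rn]] : exists n, [/\ (n0 <= n)%N, (n1 <= n)%N & reset n].
  apply: contrapT => none; apply: infinite; exists (maxn n0 n1) => n.
  by rewrite geq_max => /andP[h1 h2] rn; apply: none; exists n.
apply: infinite; exists n.+1.
have key k : D (n.+1 + k)%N <= rho + (s (n.+1 + k)%N - s n.+1) /\ ~ reset (n.+1 + k)%N.
  have noreset j : D (n.+1 + j)%N <= rho + (s (n.+1 + j)%N - s n.+1) ->
      D (n.+1 + j)%N <= kappa /\ ~ reset (n.+1 + j)%N.
    move=> Dj.
    have c1 : s (n.+1 + j)%N - s n.+1 < kappa - rho.
      by apply: hn1; lia.
    have Dk : D (n.+1 + j)%N <= kappa by lra.
    split => // rj.
    have := Dexit _ (_ : n0 <= n.+1 + j)%N Dk rj; have : (n0 <= n.+1 + j)%N by lia.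
    move=> h /(_ h).
    have c2 : s (n.+1 + j).+1 - s n.+1 < kappa - rho by apply: hn1; lia.
    lra.
  elim: k => [|k [IH nk]].
    have D0 : D (n.+1 + 0)%N <= rho + (s (n.+1 + 0)%N - s n.+1).
      by rewrite addn0 subrr addr0; exact: Dreset.
    by split=> //; have [] := noreset _ D0.
  have DS : D (n.+1 + k.+1)%N <= rho + (s (n.+1 + k.+1)%N - s n.+1).
    rewrite addnS; have [Dk _] := noreset _ IH.
    have := Dstep _ Dk nk; lra.
  by split=> //; have [] := noreset _ DS.
by move=> m nm; rewrite -(subnKC nm); have [] := key (m - n.+1)%N.
Qed.

(** [D - s] is eventually nonincreasing and bounded below, so [D] has a limit L. If L were positive,
    the drift would eventually be at least c (L / 2) a_n, and its divergent sum would drag [D - s]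
    below its bound. *)
Lemma cvg_contracting_perturbed D s a c N : 0 < c -> (forall n, 0 < a n) ->
  series a @ \oo --> +oo -> cvgn s -> (forall n, 0 <= D n) ->
  (forall n, (N <= n)%N -> D n.+1 <= D n - c * a n * D n + (s n.+1 - s n)) ->
  D @ \oo --> (0 : R).
Proof.
move=> c0 a0 aoo cs D0 step.
pose E n := D n - s n.
have Estep n : (N <= n)%N -> E n.+1 <= E n - c * a n * D n.
  by move=> /step; rewrite /E; lra.
have [N0 hN0] := cvg_eventually_close cs (@ltr01 R).
pose M := maxn N N0.
have NM : (N <= M)%N by rewrite leq_maxl.
have N0M : (N0 <= M)%N by rewrite leq_maxr.
have Elb n : - (s M + 1) <= E (n + M)%N.
  have := D0 (n + M)%N; have : s (n + M)%N - s M < 1 by apply: hN0 => //; lia.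
  rewrite /E; lra.
have Edec : nonincreasing_seq (fun n => E (n + M)%N).
  apply/nonincreasing_seqP => n; rewrite addSn.
  have /Estep : (N <= n + M)%N by lia.
  by move/le_trans; apply; rewrite gerBl !mulr_ge0// ltW.
have cE : cvgn (fun n => E (n + M)%N).
  by apply: nonincreasing_is_cvgn => //; exists (- (s M + 1)) => _ [n _ <-].
have csM : (fun n => s (n + M)%N) @ \oo --> limn s by rewrite (cvg_shiftn M s).
pose L := limn (fun n => E (n + M)%N) + limn s.
have cD : (fun n => D (n + M)%N) @ \oo --> L.
  rewrite (_ : (fun n => _) = (fun n => E (n + M)%N + s (n + M)%N)); first exact: cvgD.
  by apply/funext => n; rewrite /E subrK.
suff L0 : L = 0 by move: cD; rewrite L0 (cvg_shiftn M D).
apply/eqP; rewrite eq_le; apply/andP; split; last first.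
  by apply: (@cvgr_to_ge _ _ _ _ _ _ 0 cD); exact: nearW.
rewrite leNgt; apply/negP => L0.
have L2 : L / 2 < L by rewrite ltr_pdivrMr// ltr_pMr// ltr1n.
have [K _ hK] := cvgr_gt _ cD _ L2.
have Lp : 0 < L / 2 by rewrite divr_gt0.
have tel n : E (n + (K + M))%N <= E (K + M)%N
    - c * (L / 2) * (series a (n + (K + M))%N - series a (K + M)%N).
  elim: n => [|n IH]; first by rewrite subrr mulr0 subr0.
  have h1 := Estep (n + (K + M))%N (_ : (N <= n + (K + M))%N).
  have {}h1 := h1 ltac:(lia).
  have /= h2 := hK (n + K)%N (leq_addl _ _); rewrite -addnA in h2.
  have h3 : c * a (n + (K + M))%N * (L / 2) <= c * a (n + (K + M))%N * D (n + (K + M))%N.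
    by rewrite ler_wpM2l ?(ltW h2)// mulr_ge0// ltW.
  rewrite addSn seriesSr; lra.
(* The 2 overshoots the lower bound - (s M + 1) of [E] by one unit. *)
have /cvgryPge/(_ (series a (K + M)%N + (E (K + M)%N + s M + 2) / (c * (L / 2))))[Q _ hQ] := aoo.
have := hQ (Q + (K + M))%N (leq_addr _ _).
rewrite /= -lerBrDl ler_pdivrMr ?mulr_gt0// => h4.
have := tel Q; have := Elb (Q + K)%N; rewrite -addnA; lra.
Qed.

Lemma counter_unbounded (sigma : nat -> nat) (reset : nat -> Prop) :
  (forall n, reset n -> sigma n.+1 = (sigma n).+1) ->
  (forall n, ~ reset n -> sigma n.+1 = sigma n) ->
  (forall N, exists2 n, (N <= n)%N & reset n) ->
  forall B, exists N, forall n, (N <= n)%N -> (B <= sigma n)%N.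
Proof.
move=> inc const infinite.
have mono m k : (sigma m <= sigma (m + k))%N.
  elim: k => [|k IH]; first by rewrite addn0.
  rewrite addnS; apply: leq_trans IH _.
  by have [/inc ->|/const ->] := pselect (reset (m + k)%N).
elim=> [|B [N hN]]; first by exists 0%N.
have [n Nn rn] := infinite N; exists n.+1 => m nm.
rewrite -(subnKC nm); apply: leq_trans (mono _ _).
by rewrite inc// ltnS hN.
Qed.

End recursive_inequalities.

(** * Borel measurability in a separable space *)

Section borel_measurability.
Context {R : realType} {H : completeNormedModType R}.

Lemma borel_measurable_fun d (T : measurableType d) (f : T -> borel H) :
  (forall O : set H, open O -> measurable (f @^-1` O)) -> measurable_fun setT f.
Proof.
move=> fO; apply: (@measurability _ _ T (borel H) setT f (@open H)) => //.
by move=> _ [W oW <-]; rewrite setTI; exact: fO.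
Qed.

Lemma open_borel_measurable (O : set H) : open O -> measurable (O : set (borel H)).
Proof. by move=> oO; exact: sub_sigma_algebra. Qed.

Lemma closed_borel_measurable (A : set H) : closed A -> measurable (A : set (borel H)).
Proof.
move=> cA; rewrite -[A]setCK; apply: measurableC.
by apply: open_borel_measurable; exact: closed_openC.
Qed.

Lemma continuous_borel_measurable (f : H -> H) : continuous f ->
  measurable_fun setT (f : borel H -> borel H).
Proof.
move=> cf; apply: borel_measurable_fun => O oO; apply: open_borel_measurable.
by apply: open_comp => // x _; exact: cf.
Qed.

Lemma continuous_borel_measurableR (f : H -> R) : continuous f ->
  measurable_fun setT (f : borel H -> R).
Proof.
move=> cf; apply: (measurability _ (RGenOpens.measurableE R)).
move=> _ [_ [a [b ->]] <-]; rewrite setTI; apply: open_borel_measurable.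
by apply: open_comp; [move=> x _; exact: cf|exact: interval_open].
Qed.

Lemma separable_dense_seq : separable H ->
  exists e : nat -> H, forall x r, 0 < r -> exists n, `|x - e n| < r.
Proof.
move=> [D [/countable_injP[f finj] dD]].
(* An index that [f] does not take on [D] yields an arbitrary point, which does not harm density. *)
exists (fun n => get [set x | D x /\ f x = n]) => x r r0.
have [||y [xy Dy]] := dD (ball x r).
- by exists x; exact: ballxx.
- exact: ball_open.
exists (f y).
have -> : get [set z | D z /\ f z = f y] = y.
  have [] := @getPex _ [set z | D z /\ f z = f y]; first by exists y.
  by move=> Dz /finj; apply; exact: mem_set.
by move: xy; rewrite -ball_normE.
Qed.

(** Measurability of [f] and [g] only controls rectangles. Separability writes the preimage of an
    open set under addition as a countable union of them, indexed by two dense centres and a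
    radius. *)
Lemma measurable_borelD d (T : measurableType d) (f g : T -> borel H) :
  separable H -> measurable_fun setT f -> measurable_fun setT g ->
  measurable_fun setT (fun t => (f t : H) + (g t : H) : borel H).
Proof.
move=> /separable_dense_seq[e he] mf mg; apply: borel_measurable_fun => O oO.
pose c (pqn : nat * nat * nat) := forall x y, `|x - e pqn.1.1| < pqn.2.+1%:R^-1 ->
  `|y - e pqn.1.2| < pqn.2.+1%:R^-1 -> O (x + y).
pose B (p n : nat) : set (borel H) := [set x : H | `|x - e p| < n.+1%:R^-1].
have mB p n : measurable (B p n).
  apply: open_borel_measurable; rewrite (_ : B p n = ball (e p) n.+1%:R^-1).
    exact: ball_open.
  by rewrite -ball_normE; apply/seteqP; split => x /=; rewrite distrC.
rewrite (_ : _ @^-1` _ = \bigcup_(i in c) (f @^-1` B i.1.1 i.2 `&` g @^-1` B i.1.2 i.2)).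
  rewrite bigcup_mkcond; apply: countable_bigcupT_measurable => // i.
  case: ifP => // _; rewrite -[X in X `&` _]setTI -[X in _ `&` X]setTI.
  by apply: measurableI; [exact: mf|exact: mg].
apply/seteqP; split => [t /= Ot|t [i ci [fi gi]]]; last exact: ci.
move: oO; rewrite openE => /(_ _ Ot); rewrite /interior -nbhs_ballE => -[r /= r0 rO].
(* Four distances to the two centres are added below, hence a quarter of [r]. *)
have r4 : 0 < r / 4 by rewrite divr_gt0.
have [N _ hN] := near_infty_natSinv_lt (PosNum r4).
have /= rN := hN N (leqnn N).
have N0 : 0 < N.+1%:R^-1 :> R by rewrite invr_gt0.
have [p hp] := he (f t) _ N0; have [q hq] := he (g t) _ N0.
exists ((p, q), N) => //= x y /= hx hy; apply: rO; rewrite -ball_normE /=.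
apply: (@le_lt_trans _ _ ((`|f t - e p| + `|x - e p|) + (`|g t - e q| + `|y - e q|))).
  rewrite -[`|x - e p|]normrN -[`|y - e q|]normrN.
  apply: le_trans (lerD (ler_normD _ _) (ler_normD _ _)).
  apply: le_trans (ler_normD _ _).
  by rewrite !opprB ![_ + (e _ - _)]addrA !subrK opprD addrACA.
move: hp hq hx hy rN; move: (_^-1) => i; lra.
Qed.

End borel_measurability.

(** * Fubini for an independent pair *)

Section independent_pair.
Context {R : realType} d d1 d2 {Omega : measurableType d}
  {T1 : measurableType d1} {T2 : measurableType d2}.
Variables (P : probability Omega R) (nu : probability T2 R).
Variables (U : Omega -> T1) (V : Omega -> T2).
Hypotheses (mU : measurable_fun setT U) (mV : measurable_fun setT V).
Hypothesis indep : forall A B, measurable A -> measurable B ->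
  P (U @^-1` A `&` V @^-1` B) = (P (U @^-1` A) * nu B)%E.

Let T12 : measurableType _ := (T1 * T2)%type.
Let UV : Omega -> T12 := fun w => (U w, V w).

Let mUV : measurable_fun setT UV.
Proof. exact: measurable_fun_pair. Qed.

Let Um : {mfun Omega >-> T1} := HB.pack U (isMeasurableFun.Build _ _ _ _ U mU).
Let UVm : {mfun Omega >-> T12} :=
  HB.pack UV (isMeasurableFun.Build _ _ _ _ UV mUV).
Let PU := distribution P Um.
Let PUV := distribution P UVm.

Let PUVE A : measurable A -> PUV A = (PU \x nu)%E A.
Proof.
by move=> mA; apply/esym/product_measure_unique => // B C mB mC; exact: indep.
Qed.

Lemma ge0_integral_independent_pair (f : T12 -> \bar R) :
  measurable_fun setT f -> (forall x, 0 <= f x)%E ->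
  (\int[P]_w f (U w, V w) = \int[P]_w \int[nu]_y f (U w, y))%E.
Proof.
move=> mf f0.
rewrite -[LHS](ge0_integral_distribution UVm)//.
rewrite (eq_measure_integral (PU \x nu)%E) => [|A mA _]; last exact: PUVE.
rewrite fubini_tonelli1// (ge0_integral_distribution Um)//.
  exact: measurable_fun_fubini_tonelli_F.
by move=> x; exact: integral_ge0.
Qed.

Lemma integral_independent_pair (f : T12 -> \bar R) :
  measurable_fun setT f ->
  (\int[P]_w \int[nu]_y `|f (U w, y)| < +oo)%E ->
  (\int[P]_w f (U w, V w) = \int[P]_w \int[nu]_y f (U w, y))%E.
Proof.
move=> mf foo.
have mfa : measurable_fun setT (abse \o f) by exact: measurableT_comp.
have mFa : measurable_fun setT (fun x => \int[nu]_y `|f (x, y)|)%E.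
  by apply: (measurable_fun_fubini_tonelli_F (abse \o f)) => // x; exact: abse_ge0.
have intf : (PU \x nu)%E.-integrable setT f.
  apply/(integrable12ltyP PU nu mf).2; apply: le_lt_trans foo.
  rewrite (ge0_integral_distribution Um)//.
  by move=> x; exact: integral_ge0.
rewrite -[LHS](integral_distribution (X := UVm))//; last first.
  apply/integrableP; split; first exact: measurableT_comp mUV.
  apply: le_lt_trans foo.
  by have /= <- := ge0_integral_independent_pair mfa (fun x => abse_ge0 (f x)).
rewrite (eq_measure_integral (PU \x nu)%E) => [|A mA _]; last exact: PUVE.
have mF := measurable_fubini_F intf.
rewrite -integral12_prod_meas1// (integral_distribution (X := Um))//.
apply/integrableP; split; first exact: measurableT_comp mU.
apply: le_lt_trans foo; apply: ge0_le_integral => //.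
- by do 2 apply: measurableT_comp => //.
- exact: (measurableT_comp mFa mU).
- move=> w _; apply: le_abse_integral => //.
  exact: measurableT_comp.
Qed.

End independent_pair.

(** * Independence of a sample from its past *)

Section independent_history.
Context {R : realType} {H : completeNormedModType R}.
Context d {Omega : measurableType d} (P : probability Omega R).
Variable Y : nat -> Omega -> H.
Hypothesis mY : forall n, measurable_fun setT (Y n : Omega -> borel H).
Hypothesis indY : independent_seq P Y.

Let mYB n (B : set (borel H)) : measurable B -> measurable (Y n @^-1` B).
Proof. by move=> mB; rewrite -[X in measurable X]setTI; exact: mY. Qed.

Let cylinder n : set (set Omega) :=
  [set \bigcap_(i < n) (Y i @^-1` B i) | B in
    [set B : nat -> set (borel H) | forall i, measurable (B i)]].

(** Cylinders form a pi-system generating the past. On them the finite measures sending A to P(A,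
    Y_n in B) and to P(A) P(Y_n in B) agree, so they agree on the generated sigma-algebra. *)
Lemma independent_past n (A : set Omega) (B : set (borel H)) :
  <<s [set E | exists2 C : set (borel H), measurable C &
         exists2 i, (i < n)%N & E = Y i @^-1` C] >> A ->
  measurable B -> P (A `&` Y n @^-1` B) = (P A * P (Y n @^-1` B))%E.
Proof.
move=> hA mB.
have mcyl : cylinder n `<=` measurable.
  move=> _ [C mC <-]; apply: bigcap_measurableType => i _; exact: mYB.
have hcyl : <<s cylinder n >> A.
  move: A hA; apply: smallest_sub; first exact: smallest_sigma_algebra.
  move=> _ [C mC [i ni ->]]; apply: sub_sigma_algebra.
  exists (fun j => if j == i then C else setT) => /= [j|].
    by case: ifP => // _; exact: measurableT.
  apply/seteqP; split => [w /(_ i ni)|w /= wC j _]; first by rewrite eqxx.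
  by case: eqP => // ->.
have mYn := mYB n mB.
pose m1 : {measure set Omega -> \bar R} := mrestr P mYn.
have q0 : 0 <= fine (P (Y n @^-1` B)) by exact: fine_ge0.
pose m2 : {measure set Omega -> \bar R} := mscale (NngNum q0) P.
have m2E X : m2 X = (P (Y n @^-1` B) * P X)%E.
  rewrite /m2 /= /mscale /=. by rewrite fineK ?fin_num_measure.
suff : m1 A = m2 A by rewrite m2E muleC.
apply: (g_sigma_algebra_measure_unique (cylinder n) mcyl (fun=> setT)) => //.
- by move=> _; exists (fun=> setT) => //; apply/seteqP; split.
- by rewrite bigcup_const.
- move=> _ _ [C mC <-] [D mD <-]; exists (fun i => C i `&` D i).
    by move=> i; exact: measurableI.
  by rewrite -bigcapI; apply: eq_bigcapr => i _; rewrite preimage_setI.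
- move=> _ [C mC <-].
  rewrite m2E /m1 /= /mrestr.
  (* Placing [B] at coordinate [n] turns the event into a cylinder of length n + 1, to which [indY]
     applies. *)
  pose C' i := if i == n then B else C i.
  have mC' i : measurable (C' i) by rewrite /C'; case: ifP.
  have C'C i : (i < n)%N -> C' i = C i by rewrite /C' => /ltn_eqF ->.
  have C'n : C' n = B by rewrite /C' eqxx.
  rewrite indY// muleC -C'n.
  rewrite (eq_bigr (fun i : 'I_n => P (Y i @^-1` C' i))); last first.
    by move=> i _; rewrite C'C.
  transitivity (\prod_(i < n.+1) P (Y i @^-1` C' i))%E; last by rewrite big_ord_recr.
  rewrite -indY//; congr (P _).
  apply/seteqP; split => [w [wC wn] i|w wC].
    rewrite /= ltnS leq_eqVlt => /orP[/eqP ->//|ni]; rewrite C'C//; exact: wC.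
  split; last exact: wC (ltnSn n).
  by move=> i /= ni; rewrite -C'C//; apply: wC => /=; exact: ltnW.
- by move=> k; rewrite /m1 /mrestr; exact/fin_num_fun_lty/fin_num_measure.
Qed.

End independent_history.

Lemma measurable_fun_coarser (T : pointedType) d' (T' : measurableType d')
    (G1 G2 : set (set T)) (f : T -> T') : <<s G1 >> `<=` <<s G2 >> ->
  measurable_fun setT (f : g_sigma_algebraType G1 -> T') ->
  measurable_fun setT (f : g_sigma_algebraType G2 -> T').
Proof. by move=> G12 mf _ A mA; apply: G12; exact: mf. Qed.

(** * Almost sure convergence of martingale series *)

Section martingale_series.
Context {R : realType} d {Omega : measurableType d} (P : probability Omega R).
Variable G : nat -> set (set Omega).
Hypothesis GP : forall n, <<s G n >> `<=` measurable.
Hypothesis Gmono : forall n, <<s G n >> `<=` <<s G n.+1 >>.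
Variables (xi : nat -> Omega -> R) (C : R).
Hypothesis mxi : forall n, measurable_fun setT (xi n : g_sigma_algebraType (G n.+1) -> R).
Hypothesis xi2 : forall n, (\int[P]_w (xi n w ^+ 2)%:E <= C%:E)%E.
Hypothesis xi_orth : forall n (Y : Omega -> R) (M : R),
  measurable_fun setT (Y : g_sigma_algebraType (G n) -> R) ->
  (forall w, `|Y w| <= M) -> (\int[P]_w (Y w * xi n w)%:E = 0)%E.
Variable a : nat -> R.

Lemma measurable_fun_filtration d' (T' : measurableType d') n (f : Omega -> T') :
  measurable_fun setT (f : g_sigma_algebraType (G n) -> T') -> measurable_fun setT f.
Proof. by move=> mf _ A mA; apply: (GP (n := n)); exact: mf. Qed.

Let mxiP n : measurable_fun setT (xi n).
Proof. exact: measurable_fun_filtration (@mxi n). Qed.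

Let ixi2 n : P.-integrable setT (fun w => (xi n w ^+ 2)%:E).
Proof.
apply/integrableP; split.
  by apply/measurable_EFinP; apply: measurable_funX.
apply: le_lt_trans (ltry C); apply: le_trans (xi2 n).
by apply: ge0_le_integral => //;
  [apply/measurable_EFinP; apply: measurableT_comp => //; exact: measurable_funX|
   apply/measurable_EFinP; exact: measurable_funX|
   move=> w _; rewrite /= ger0_norm// exprn_even_ge0].
Qed.

Section stopped_process.
Variable eps : R.
Hypothesis eps0 : 0 < eps.

(* The partial sums from [n] on, frozen once they leave ]-eps, eps[: Chebyshev's
   inequality for this process is Kolmogorov's maximal inequality, and since it is
   bounded by [eps] before freezing, its increments only need to be orthogonal to
   bounded adapted functions. *)
Fixpoint stopped n j (w : Omega) : R :=
  if j is i.+1 then stopped n i w +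
    (if `|stopped n i w| < eps then a (n + i)%N * xi (n + i)%N w else 0)
  else 0.

Lemma measurable_stopped n j :
  measurable_fun setT (stopped n j : g_sigma_algebraType (G (n + j)%N) -> R).
Proof.
elim: j => [|j IH]; first exact: measurable_cst.
rewrite addnS; have {}IH := measurable_fun_coarser (@Gmono (n + j)%N) IH.
apply: measurable_funD => //; apply: measurable_fun_ifT => //.
  by apply: measurable_fun_ltr => //; exact: measurableT_comp.
by apply: measurable_funM => //; exact: mxi.
Qed.

Let mst n j : measurable_fun setT (stopped n j).
Proof. exact: measurable_fun_filtration (@measurable_stopped n j). Qed.

Let mst2 n j : measurable_fun setT (fun w => (stopped n j w ^+ 2)%:E).
Proof. by apply/measurable_EFinP; exact: measurable_funX. Qed.

Lemma stopped_second_moment n j :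
  (\int[P]_w (stopped n j w ^+ 2)%:E <=
   (C * \sum_(i < j) a (n + i)%N ^+ 2)%:E)%E.
Proof.
elim: j => [|j IH].
  rewrite big_ord0 mulr0 (eq_integral (cst 0%E)) ?integral0// => w _ /=.
  by rewrite expr0n.
(* [Y] agrees with the process wherever the increment is not frozen, and it is bounded by [eps]; the
   cross term is thus 2 a Y xi, killed by [xi_orth]. *)
pose Y w := if `|stopped n j w| < eps then stopped n j w else 0.
have Yeps w : `|Y w| <= eps.
  by rewrite /Y; case: ifP => [/ltW//|_]; rewrite normr0 ltW.
have mY : measurable_fun setT (Y : g_sigma_algebraType (G (n + j)%N) -> R).
  have m1 := @measurable_stopped n j; apply: measurable_fun_ifT => //.
  by apply: measurable_fun_ltr => //; exact: measurableT_comp.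
have mYP := measurable_fun_filtration mY.
have i1 : P.-integrable setT (fun w => (stopped n j w ^+ 2)%:E).
  apply/integrableP; split => //; apply: le_lt_trans (ltry _); apply: le_trans IH.
  rewrite le_eqVlt; apply/orP; left; apply/eqP; apply: eq_integral => w _ /=.
  by rewrite ger0_norm ?exprn_even_ge0.
have i2 : P.-integrable setT (fun w => (Y w * xi (n + j)%N w)%:E).
  apply: (@le_integrable _ _ _ _ _ _ _ (fun w => (eps * (1 + xi (n + j)%N w ^+ 2))%:E)) => //.
  - by apply/measurable_EFinP; exact: measurable_funM.
  - move=> w _; rewrite lee_fin normrM.
    rewrite [X in _ <= X]ger0_norm; last first.
      by apply: mulr_ge0; [exact: ltW|apply: addr_ge0 => //; exact: sqr_ge0].
    apply: ler_pM => //; rewrite -[xi _ _ ^+ 2]real_normK ?num_real//.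
    move: (`|xi _ _|) (normr_ge0 (xi (n + j)%N w)) => x x0; nra.
  - under eq_fun do rewrite EFinM EFinD.
    apply: integrableZl => //; apply: integrableD => //.
    exact: finite_measure_integrable_cst.
pose f w := (stopped n j w ^+ 2)%:E.
pose g w := ((2 * a (n + j)%N)%:E * (Y w * xi (n + j)%N w)%:E)%E.
pose h w := ((a (n + j)%N ^+ 2)%:E * (xi (n + j)%N w ^+ 2)%:E)%E.
have ig : P.-integrable setT (fun w => g w) by exact: integrableZl.
have ih : P.-integrable setT (fun w => h w) by exact: integrableZl.
apply: (@le_trans _ _ (\int[P]_w (f w + g w + h w))%E).
  apply: ge0_le_integral => //.
  - by move=> w _; rewrite lee_fin sqr_ge0.
  - exact: measurable_int (integrableD _ (integrableD _ i1 ig) ih).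
  - move=> w _; rewrite /f /g /h -!EFinM -!EFinD lee_fin /= /Y.
    case: ifP => _; last by rewrite addr0 mul0r mulr0 addr0 lerDl mulr_ge0 ?sqr_ge0.
    rewrite le_eqVlt; apply/orP; left; apply/eqP; ring.
rewrite integralD//; last exact: integrableD.
rewrite integralD// integralZl// (xi_orth mY Yeps) mule0 adde0 integralZl//.
rewrite big_ord_recr/= mulrDr EFinD; apply: leeD => //.
rewrite [C * _]mulrC [X in (_ <= X)%E]EFinM; apply: lee_wpmul2l => //.
by rewrite lee_fin sqr_ge0.
Qed.

Let C0 : 0 <= C.
Proof.
rewrite -lee_fin; apply: le_trans (xi2 0%N).
by apply: integral_ge0 => w _; rewrite lee_fin sqr_ge0.
Qed.

Let exited n j : set Omega := [set w | eps <= `|stopped n j w|].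

Let mexited n j : measurable (exited n j).
Proof.
rewrite -[X in measurable X]setTI.
have : measurable_fun setT (fun w => eps <= `|stopped n j w|).
  by apply: measurable_fun_ler => //; exact: measurableT_comp.
by move/(_ measurableT [set true] (I : measurable [set true])).
Qed.

Lemma stopped_exit_le n j :
  (P (exited n j) <= (C / eps ^+ 2 * \sum_(i < j) a (n + i)%N ^+ 2)%:E)%E.
Proof.
have e2 : 0 < eps ^+ 2 by exact: exprn_gt0.
suff : ((eps ^+ 2)%:E * P (exited n j) <= (C * \sum_(i < j) a (n + i)%N ^+ 2)%:E)%E.
  by rewrite -lee_pdivlMl// -EFinM [X in X%:E]mulrA [_^-1 * C]mulrC.
rewrite -integral_cst//; apply: le_trans (stopped_second_moment n j).
apply: (@le_trans _ _ (\int[P]_(w in exited n j) (stopped n j w ^+ 2)%:E)%E).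
  apply: ge0_le_integral => //.
  - by move=> w _ /=; rewrite lee_fin ltW.
  - exact: measurable_funTS.
  - move=> w /= ew; rewrite lee_fin -[X in _ <= X]real_normK ?num_real//.
    by rewrite lerXn2r// nnegrE// ltW.
by apply: ge0_subset_integral => // w _; rewrite lee_fin sqr_ge0.
Qed.

(** Freezing makes an exit permanent. Hence the probability of ever leaving is a limit of
    probabilities at single times, which turns Chebyshev into a maximal inequality. *)
Lemma exited_nondecreasing n : nondecreasing_seq (exited n).
Proof.
apply/nondecreasing_seqP => j; apply/subsetPset => w.
by rewrite /exited /= => ew; rewrite ltNge ew addr0.
Qed.

Hypothesis a2 : cvgn (series (fun n => a n ^+ 2)).

Lemma exit_le n : (P (\bigcup_j exited n j) <=
  (C / eps ^+ 2 * (limn (series (fun n => a n ^+ 2)) - series (fun n => a n ^+ 2) n))%:E)%E.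
Proof.
have cP := nondecreasing_cvg_mu (mu := P) (mexited n)
  (bigcup_measurable (fun j _ => mexited n j)) (exited_nondecreasing n).
rewrite -(cvg_lim _ cP)//; apply: lime_le; first by apply/cvg_ex; exists (P (\bigcup_j exited n j)).
apply: nearW => j; apply: le_trans (stopped_exit_le n j) _.
rewrite lee_fin ler_wpM2l// ?divr_ge0 ?sqr_ge0//.
rewrite lerBrDl.
have -> : series (fun n => a n ^+ 2) n + \sum_(i < j) a (n + i)%N ^+ 2 =
    series (fun n => a n ^+ 2) (n + j)%N.
  rewrite /series /= [RHS](@big_cat_nat _ _ _ n)//= ?leq_addr//; congr (_ + _).
  by rewrite -[X in \big[_/_]_(X <= _ < _) _]add0n big_addn addKn big_mkord; apply: eq_bigr => i _; rewrite addnC.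
apply: nondecreasing_cvgn_le => //; apply/nondecreasing_seqP => k.
by rewrite seriesSr lerDl sqr_ge0.
Qed.

(** This event lies in every exit event, whose probabilities are bounded by tails of the convergent
    series of a_n^2. *)
Lemma negligible_exit : P.-negligible (\bigcap_n \bigcup_j exited n j).
Proof.
have mB n : measurable (\bigcup_j exited n j) by exact: bigcup_measurable.
apply/negligibleP; first exact: bigcap_measurableType.
apply/eqP; rewrite eq_le measure_ge0 andbT.
pose u n := C / eps ^+ 2 * (limn (series (fun n => a n ^+ 2)) - series (fun n => a n ^+ 2) n).
have cu : u @ \oo --> 0.
  rewrite -[X in _ --> X](mulr0 (C / eps ^+ 2)); apply: cvgM; first exact: cvg_cst.
  rewrite -[X in _ --> X](subrr (limn (series (fun n => a n ^+ 2)))).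
  by apply: cvgB => //; exact: cvg_cst.
have cu' : (fun n => (u n)%:E) @ \oo --> 0%E by apply: cvg_EFin => //; exact: nearW.
apply: (cvge_to_ge cu'); apply: nearW => n; apply: le_trans (exit_le n).
by apply: le_measure; rewrite ?inE//; [exact: bigcap_measurableType|exact: bigcap_inf].
Qed.

Lemma not_exited n w : ~ (\bigcup_j exited n j) w -> forall j,
  `|series (fun k => a k * xi k w) (n + j)%N - series (fun k => a k * xi k w) n| < eps.
Proof.
move=> nB j.
have small i : `|stopped n i w| < eps.
  by rewrite ltNge; apply/negP => ew; apply: nB; exists i.
suff <- : stopped n j w =
    series (fun k => a k * xi k w) (n + j)%N - series (fun k => a k * xi k w) n by [].
elim: j => [|j IH]; first by rewrite addn0 subrr.
by rewrite /= small addnS seriesSr IH addrAC.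
Qed.

End stopped_process.

(** Off the null sets for eps = 1 / (k + 1), some tail of the partial sums stays within eps of its
    first term, for every k: the sums are Cauchy. *)
Lemma martingale_series_cvg_ae : cvgn (series (fun n => a n ^+ 2)) ->
  {ae P, forall w, cvgn (series (fun k => a k * xi k w))}.
Proof.
move=> a2.
have e0 k : 0 < k.+1%:R^-1 :> R by rewrite invr_gt0.
have := negligible_bigcup (fun k => negligible_exit (e0 k) a2).
apply: negligibleS => w /= ncv; apply: contrapT => nB; apply: ncv.
apply: cauchy_cvg; apply: cauchy_exP => e epos.
have [k _ hk] := near_infty_natSinv_lt (PosNum epos).
have /existsNP[n nBn] : ~ forall n, True -> (\bigcup_j [set w | k.+1%:R^-1 <= `|stopped k.+1%:R^-1 n j w|]) w.
  by move=> h; apply: nB; exists k.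
exists (series (fun k => a k * xi k w) n); exists n => // m /= nm.
have {}nBn : ~ (\bigcup_j [set w | k.+1%:R^-1 <= `|stopped k.+1%:R^-1 n j w|]) w.
  by move=> h; apply: nBn.
rewrite -ball_normE /= distrC -(subnKC nm).
by apply: lt_trans (not_exited nBn _) _; exact: (hk k (leqnn k)).
Qed.

End martingale_series.

Lemma integral_prob_cst {R : realType} d {T : measurableType d} (nu : probability T R)
  (r : R) : (\int[nu]_y r%:E = r%:E)%E.
Proof.
rewrite (_ : integral _ _ _ = r%:E * nu setT)%E; last exact: integral_cst.
by rewrite probability_setT mule1.
Qed.

(** * Second moments and series with summable expectations *)

Section square_integrable.
Context {R : realType} d {T : measurableType d} (nu : probability T R).
Variables (h : T -> R) (D : R).
Hypotheses (mh : measurable_fun setT h) (h2 : (\int[nu]_y (h y ^+ 2)%:E <= D%:E)%E).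

Lemma integrable_sqr : nu.-integrable setT (fun y => (h y ^+ 2)%:E).
Proof.
apply/integrableP; split; first by apply/measurable_EFinP; exact: measurable_funX.
apply: le_lt_trans (ltry D); apply: le_trans h2.
rewrite le_eqVlt; apply/orP; left; apply/eqP; apply: eq_integral => w _ /=.
by rewrite ger0_norm ?sqr_ge0.
Qed.

Lemma square_integrable_integrable : nu.-integrable setT (fun y => (h y)%:E).
Proof.
apply: (@le_integrable _ _ _ _ _ _ _ (fun y => (1 + h y ^+ 2)%:E)) => //.
- exact/measurable_EFinP.
- move=> w _; rewrite lee_fin [X in _ <= X]ger0_norm ?addr_ge0 ?sqr_ge0//.
  rewrite -[h w ^+ 2]real_normK ?num_real//.
  move: (`|h w|) (normr_ge0 (h w)) => x x0; nra.
- under eq_fun do rewrite EFinD; apply: integrableD => //.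
    exact: finite_measure_integrable_cst.
  exact: integrable_sqr.
Qed.

Lemma integral_centered (q := \int[nu]_y h y) : (\int[nu]_y (h y - q)%:E = 0)%E.
Proof.
have ih := square_integrable_integrable.
under eq_integral do rewrite EFinB.
rewrite integralB//; last exact: finite_measure_integrable_cst.
rewrite integral_prob_cst /q /Rintegral fineK ?subee//.
- exact: integrable_fin_num.
- exact: integrable_fin_num.
Qed.

Lemma centered_second_moment (q := \int[nu]_y h y) :
  (\int[nu]_y ((h y - q) ^+ 2)%:E <= D%:E)%E.
Proof.
have ih := square_integrable_integrable.
have E : (\int[nu]_y (h y)%:E = q%:E)%E.
  by rewrite /q /Rintegral fineK//; exact: integrable_fin_num.
rewrite (eq_integral (fun y => ((h y ^+ 2)%:E + ((- (2 * q))%:E * (h y)%:E + (q ^+ 2)%:E))%E));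
  last first.
  by move=> y _; rewrite -EFinM -!EFinD; congr EFin; ring.
have i1 : nu.-integrable setT (fun y => (- (2 * q))%:E * (h y)%:E)%E by exact: integrableZl.
have i2 : nu.-integrable setT (fun y => (q ^+ 2)%:E) by exact: finite_measure_integrable_cst.
rewrite integralD//; [|exact: integrable_sqr|exact: integrableD].
rewrite integralD// integralZl// integral_prob_cst E -EFinM -EFinD.
apply: le_trans h2; rewrite geeDl// lee_fin.
have := sqr_ge0 q; nra.
Qed.

End square_integrable.

Section nonnegative_series.
Context {R : realType} d {Omega : measurableType d} (P : probability Omega R).

(** By monotone convergence the sum has expectation at most C times the sum of [b], so it is finite
    almost everywhere. *)
Lemma nonneg_series_cvg_ae (eta : nat -> Omega -> R) (b : nat -> R) (C : R) :
  (forall n, measurable_fun setT (eta n)) -> (forall n w, 0 <= eta n w) ->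
  (forall n, (\int[P]_w (eta n w)%:E <= C%:E)%E) ->
  (forall n, 0 <= b n) -> cvgn (series b) ->
  {ae P, forall w, cvgn (series (fun n => b n * eta n w))}.
Proof.
move=> meta eta0 etaC b0 cb.
have C0 : 0 <= C.
  by rewrite -lee_fin; apply: le_trans (etaC 0%N); apply: integral_ge0 => w _; rewrite lee_fin.
pose f n w := (b n * eta n w)%:E.
have f0 n w : (0 <= f n w)%E by rewrite lee_fin mulr_ge0.
have mf n : measurable_fun setT (f n).
  by apply/measurable_EFinP; exact: measurable_funM.
have fC n : (\int[P]_w f n w <= (b n * C)%:E)%E.
  under eq_integral do rewrite /f EFinM.
  rewrite ge0_integralZl_EFin//; first by rewrite EFinM lee_wpmul2l// lee_fin.
    by move=> w _; rewrite lee_fin.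
  exact/measurable_EFinP.
have mS : measurable_fun setT (fun w => \sum_(n <oo) f n w)%E.
  by apply: ge0_emeasurable_sum.
have S0 w : (0 <= \sum_(n <oo) f n w)%E by apply: nneseries_ge0 => n _ _; exact: f0.
have iS : P.-integrable setT (fun w => \sum_(n <oo) f n w)%E.
  apply/integrableP; split => //.
  under eq_integral do rewrite gee0_abs//.
  rewrite integral_nneseries//; apply: (@le_lt_trans _ _ (limn (series b) * C)%:E); last exact: ltry.
  apply: lime_le; first by apply: is_cvg_nneseries => n _ _; exact: integral_ge0.
  apply: nearW => n; apply: (@le_trans _ _ (\sum_(0 <= k < n) (b k * C)%:E)%E).
    exact: lee_sum.
  rewrite sumEFin lee_fin -mulr_suml ler_wpM2r//.
  apply: nondecreasing_cvgn_le => //; apply/nondecreasing_seqP => k.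
  by rewrite seriesSr lerDl.
have := integrable_ae measurableT iS; apply: filterS => w /(_ I) Sfin.
apply: nondecreasing_is_cvgn.
  by apply/nondecreasing_seqP => k; rewrite seriesSr lerDl mulr_ge0.
exists (fine (\sum_(n <oo) f n w)%E) => _ [n _ <-].
rewrite -lee_fin fineK// /series /= -sumEFin.
by apply: nneseries_lim_ge => k _ _; exact: f0.
Qed.

End nonnegative_series.

(** Integrability is not assumed: the integral is the difference of those of the positive and
    negative parts, and Tonelli applies to each. *)
Lemma measurable_fun_integral {R : realType} d1 d2 {T1 : measurableType d1}
    {T2 : measurableType d2} (nu : probability T2 R) (f : T1 * T2 -> \bar R) :
  measurable_fun setT f -> measurable_fun setT (fun x => \int[nu]_y f (x, y))%E.
Proof.
move=> mf.
have -> : (fun x => \int[nu]_y f (x, y))%E =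
    (fun x => \int[nu]_y f^\+ (x, y) - \int[nu]_y f^\- (x, y))%E.
  apply/funext => x; rewrite [LHS]integralE.
  under eq_integral do rewrite funepos_comp/=.
  by under [X in (_ - X)%E = _]eq_integral do rewrite funeneg_comp/=.
apply: emeasurable_funB.
- by apply: (measurable_fun_fubini_tonelli_F (f^\+)%E) => //; exact: measurable_funepos.
- by apply: (measurable_fun_fubini_tonelli_F (f^\-)%E) => //; exact: measurable_funeneg.
Qed.

(** * Noise as a function of the past and a fresh sample *)

Section kernel_noise.
Context {R : realType} d {Omega : measurableType d} (P : probability Omega R).
Context d2 {T2 : measurableType d2} (nu : probability T2 R).
Variable G : nat -> set (set Omega).
Hypothesis GP : forall n, <<s G n >> `<=` measurable.
Hypothesis Gmono : forall n, <<s G n >> `<=` <<s G n.+1 >>.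
Variable v : nat -> Omega -> T2.
Hypothesis mv : forall n, measurable_fun setT (v n : g_sigma_algebraType (G n.+1) -> T2).
Hypothesis indep : forall n A B, <<s G n >> A -> measurable B ->
  P (A `&` v n @^-1` B) = (P A * nu B)%E.
Variable h : nat -> Omega -> T2 -> R.
Hypothesis mh : forall n,
  measurable_fun setT (fun z : g_sigma_algebraType (G n) * T2 => h n z.1 z.2).

(** The first member of the independent pair is the point w itself, read in the coarser
    sigma-algebra of [G n]. Integrating [h n w] over the sample then plays the role of conditioning
    on the past. *)
Let mid n : measurable_fun setT (idfun : Omega -> g_sigma_algebraType (G n)).
Proof. by move=> _ A mA; rewrite setTI; apply: (@GP n). Qed.

Let mvP n : measurable_fun setT (v n).
Proof. exact: (measurable_fun_filtration (@GP) (@mv n)). Qed.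

Let mh1 n w : measurable_fun setT (h n w).
Proof. exact: (measurableT_comp (@mh n) (pair1_measurable (w : g_sigma_algebraType (G n)))). Qed.

Lemma measurable_kernel_at n :
  measurable_fun setT ((fun w => h n w (v n w)) : g_sigma_algebraType (G n.+1) -> R).
Proof.
have m1 : measurable_fun setT
    ((fun w => (w, v n w)) : g_sigma_algebraType (G n.+1) -> g_sigma_algebraType (G n) * T2).
  apply: measurable_fun_pair; last exact: mv.
  by move=> _ A mA; rewrite setTI; apply: (@Gmono n).
exact: (measurableT_comp (@mh n) m1).
Qed.

Lemma measurable_kernel_mean n :
  measurable_fun setT ((fun w => \int[nu]_y h n w y) : g_sigma_algebraType (G n) -> R).
Proof.
have mf : measurable_fun setT
    (fun z : g_sigma_algebraType (G n) * T2 => (h n z.1 z.2)%:E).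
  exact/measurable_EFinP.
have mF := measurable_fun_integral nu mf.
exact: (measurableT_comp (f := fine) _ mF).
Qed.

Lemma nonneg_noise_series_cvg_ae (b : nat -> R) (C : R) :
  (forall n w y, 0 <= h n w y) ->
  (forall n w, \int[nu]_y (h n w y)%:E <= C%:E)%E ->
  (forall n, 0 <= b n) -> cvgn (series b) ->
  {ae P, forall w, cvgn (series (fun n => b n * h n w (v n w)))}.
Proof.
move=> h0 hC b0 cb; apply: (nonneg_series_cvg_ae (C := C)) => // n.
  exact: (measurable_fun_filtration (@GP) (@measurable_kernel_at n)).
have mf : measurable_fun setT
    (fun z : g_sigma_algebraType (G n) * T2 => (h n z.1 z.2)%:E).
  exact/measurable_EFinP.
have -> := ge0_integral_independent_pair (@mid n) (@mvP n) (@indep n) mf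
  (fun z => h0 n z.1 z.2).
have mF := measurable_fun_filtration (@GP) (measurable_fun_integral nu mf).
apply: (@le_trans _ _ (\int[P]_w C%:E)%E).
  apply: ge0_le_integral => //.
  - by move=> w _; apply: integral_ge0 => y _; rewrite lee_fin; exact: h0.
  - by move=> w _; exact: hC.
by rewrite integral_prob_cst.
Qed.

(** When the sample is integrated first, an adapted factor leaves the inner integral, and what
    remains vanishes by centering. Centering does not increase second moments. *)
Lemma centered_noise_series_cvg_ae (a : nat -> R) (D : R) :
  (forall n w, \int[nu]_y (h n w y ^+ 2)%:E <= D%:E)%E ->
  cvgn (series (fun n => a n ^+ 2)) ->
  {ae P, forall w, cvgn (series (fun n => a n * (h n w (v n w) - \int[nu]_y h n w y)))}.
Proof.
move=> hD a2.
pose q n w := \int[nu]_y h n w y.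
pose g n (z : g_sigma_algebraType (G n) * T2) := h n z.1 z.2 - q n z.1.
have mg n : measurable_fun setT (@g n).
  apply: measurable_funB; first exact: mh.
  exact: (measurableT_comp (@measurable_kernel_mean n) measurable_fst).
have mg2 n : measurable_fun setT (fun z => (g n z ^+ 2)%:E).
  by apply/measurable_EFinP; exact: measurable_funX.
have g2D n w : (\int[nu]_y (g n (w, y) ^+ 2)%:E <= D%:E)%E.
  exact: (centered_second_moment (@mh1 n w) (hD n w)).
apply: (@martingale_series_cvg_ae _ _ _ P G (@GP) (@Gmono) _ D) => // n.
- apply: measurable_funB; first exact: measurable_kernel_at.
  exact: measurable_fun_coarser (@Gmono n) (@measurable_kernel_mean n).
- have g20 z : (0 <= (g n z ^+ 2)%:E)%E by rewrite lee_fin sqr_ge0.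
  have /= -> := ge0_integral_independent_pair (@mid n) (@mvP n) (@indep n) (@mg2 n) g20.
  have mF := measurable_fun_filtration (@GP) (measurable_fun_integral nu (@mg2 n)).
  apply: (@le_trans _ _ (\int[P]_w D%:E)%E); last by rewrite integral_prob_cst.
  apply: ge0_le_integral => //.
  by move=> w _; exact: integral_ge0.
- move=> Y M mY YM.
  have mYg : measurable_fun setT
      (fun z : g_sigma_algebraType (G n) * T2 => (Y z.1 * g n z)%:E).
    apply/measurable_EFinP; apply: measurable_funM => //.
    exact: (measurableT_comp mY measurable_fst).
  have /= -> := integral_independent_pair (@mid n) (@mvP n) (@indep n) mYg.
    rewrite (eq_integral (cst 0%E)) ?integral0// => w _ /=.
    under eq_integral do rewrite EFinM.
    have ig : nu.-integrable setT (fun y => (g n (w, y))%:E).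
      apply: square_integrable_integrable (g2D n w).
      exact: (measurableT_comp (@mg n) (pair1_measurable (w : g_sigma_algebraType (G n)))).
    by rewrite integralZl// /g/= (integral_centered (@mh1 n w) (hD n w)) mule0.
  have M0 : 0 <= M by exact: le_trans (normr_ge0 _) (YM point).
  have mYga : measurable_fun setT
      (fun z : g_sigma_algebraType (G n) * T2 => `|(Y z.1 * g n z)%:E|%E).
    exact: measurableT_comp.
  have mF := measurable_fun_filtration (@GP) (measurable_fun_integral nu mYga).
  (* From |Y g| <= M (1 + g^2) and the second moment bound on g. *)
  apply: (@le_lt_trans _ _ (\int[P]_w (M * (1 + D))%:E)%E).
    apply: ge0_le_integral => //.
    + by move=> w _; exact: integral_ge0.
    + move=> w _; have mgw : measurable_fun setT (fun y => g n (w, y)).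
        exact: (measurableT_comp (@mg n) (pair1_measurable (w : g_sigma_algebraType (G n)))).
      have mgw2 : measurable_fun setT (fun y => (1 + g n (w, y) ^+ 2)%:E).
        apply/measurable_EFinP; apply: measurable_funD => //.
        exact: measurable_funX.
      apply: (@le_trans _ _ (\int[nu]_y (M%:E * (1 + g n (w, y) ^+ 2)%:E))%E).
        apply: ge0_le_integral => //.
        * exact: (measurableT_comp mYga (pair1_measurable (w : g_sigma_algebraType (G n)))).
        * exact: measurable_funeM.
        * move=> y _; rewrite -EFinM lee_fin normrM; apply: ler_pM => //.
          rewrite -[g n _ ^+ 2]real_normK ?num_real//.
          move: (`|g n _|) (normr_ge0 (g n (w, y))) => x x0; nra.
      rewrite ge0_integralZl_EFin//; last first.
        by move=> y _; rewrite lee_fin addr_ge0// sqr_ge0.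
      rewrite EFinM; apply: lee_wpmul2l; first by rewrite lee_fin.
      under eq_integral do rewrite EFinD.
      rewrite ge0_integralD//; last 2 first.
      * by move=> y _; rewrite lee_fin sqr_ge0.
      * by apply/measurable_EFinP; exact: measurable_funX.
      by rewrite integral_prob_cst EFinD leeD2l.
  by rewrite integral_prob_cst ltry.
Qed.

End kernel_noise.

(** * Derivatives along segments *)

Section strong_monotonicity.
Context {R : realType} {H : completeNormedModType R}.

Lemma gateaux_line (f : H -> R) (x u : H) (t l : R) :
  gateaux f (x + t *: u) u l -> is_derive t (1 : R) (fun s => f (x + s *: u)) l.
Proof.
pose phi s := f (x + s *: u); pose psi s := f (x + t *: u + s *: u).
have E : (fun h : R => h^-1 *: ((phi \o shift t) (h *: 1) - phi t)) =
         (fun h : R => h^-1 *: ((psi \o shift 0) (h *: 1) - psi 0)).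
  apply/funext => h; rewrite /phi /psi /= scale0r !addr0 -addrA -scalerDl.
  by rewrite [t + _]addrC.
case=> d1 d2; split; first by move: d1; rewrite /derivable -/phi -/psi E.
by rewrite -d2 /derive -/phi -/psi E.
Qed.

Lemma convex_set_segment (U : set H) (x y : H) (t : R) :
  convex_set (U : set (convex_lmodType H)) -> U x -> U y -> 0 <= t <= 1 ->
  U (x + t *: (y - x)).
Proof.
move=> cU Ux Uy /andP[t0 t1].
have UU : U (t *: y + (1 - t) *: x) :=
  set_mem (cU y x (Itv01 t0 t1) (mem_set Uy) (mem_set Ux)).
rewrite (_ : x + _ = t *: y + (1 - t) *: x)//.
by rewrite scalerBr scalerBl scale1r addrCA.
Qed.

End strong_monotonicity.

(** * Measurability of the inner product by polarization *)

Section inner_product_measurability.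
Context {R : realType} {H : completeNormedModType R} {ip : {dot H for idfun}}.
Hypotheses (hip : norm_from_ip ip) (hsep : separable H).
Context d {T : measurableType d}.
Implicit Types f g : T -> borel H.

Lemma measurable_borel_norm f : measurable_fun setT f ->
  measurable_fun setT (fun t => `|f t : H|).
Proof.
move=> mf; apply: (measurableT_comp (f := fun x : borel H => `|x : H|) _ mf).
by apply: continuous_borel_measurableR => x; exact: norm_continuous.
Qed.

Lemma measurable_ip f g : measurable_fun setT f -> measurable_fun setT g ->
  measurable_fun setT (fun t => ip (f t) (g t)).
Proof.
move=> mf mg.
rewrite (_ : (fun t => _) = (fun t => 2^-1 *
    (`|(f t : H) + (g t : H)| ^+ 2 - `|f t : H| ^+ 2 - `|g t : H| ^+ 2))).
  apply: measurable_funM => //; apply: measurable_funB; [apply: measurable_funB|];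
    apply: measurable_funX; apply: measurable_borel_norm => //.
  exact: measurable_borelD.
apply/funext => t; by rewrite -!(ip_norm hip) !ipE (ipC (g t)); field.
Qed.

End inner_product_measurability.

(** * The stochastic gradient iteration *)

Section stochastic_gradient.
Context {R : realType} {H : completeNormedModType R} {ip : {dot H for idfun}}.
Context {C0 S : {linear H -> H}}.
Hypotheses (hip : norm_from_ip ip) (hsep : separable H) (hS : is_sqrt_op ip C0 S).
Variables (nu0 : probability (borel H) R) (m0 mstar : H).
Hypotheses (hm0 : cm_space S m0) (hmstar : cm_space S mstar).
Variables (dPhi : H -> H) (d2Phi : H -> {linear H -> H}).
Hypothesis mdPhi : measurable_fun setT (dPhi : borel H -> borel H).

Local Notation cm := (cm_space S).
Local Notation T := (inv_sqrt ip S).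
Local Notation nrm := (cm_norm ip S).

(** Mean value theorem for t -> J'(mstar + t u) u on [0, 1] with u = m - mstar fixed: it starts at
    0, and convexity keeps the segment in [U], where the second variation is bounded below. *)
Lemma strongly_monotone_gradient (U : set H) (alpha : R) m :
  (forall x, cm x -> forall u w, cm u -> cm w ->
     gateaux (fun m' => J' ip S nu0 m0 dPhi m' w) x u (J'' ip S nu0 d2Phi x u w)) ->
  (forall h, cm h -> J' ip S nu0 m0 dPhi mstar h = 0) ->
  convex_set (U : set (convex_lmodType H)) -> U `<=` cm -> U mstar ->
  (forall x u, U x -> cm u -> alpha * nrm u ^+ 2 <= J'' ip S nu0 d2Phi x u u) ->
  U m -> alpha * nrm (m - mstar) ^+ 2 <= J' ip S nu0 m0 dPhi m (m - mstar).
Proof.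
move=> dJ' crit cU Ucm Us conv Um.
pose u := m - mstar; have cu : cm u by apply: cm_spaceB => //; exact: Ucm.
pose phi t := J' ip S nu0 m0 dPhi (mstar + t *: u) u.
have dphi (t : R) : is_derive t (1 : R) phi (J'' ip S nu0 d2Phi (mstar + t *: u) u u).
  apply: (gateaux_line (f := fun x => J' ip S nu0 m0 dPhi x u)); apply: dJ' => //.
  by apply: cm_spaceD => //; exact: cm_spaceZ.
have [|c c01] := @MVT R phi (fun t => J'' ip S nu0 d2Phi (mstar + t *: u) u u) 0 1 ltr01.
  by apply: derivable_within_continuous => t _; have [] := dphi t.
rewrite /phi scale0r addr0 crit// scale1r subr0 subr0 mulr1 /u subrKC => ->.
apply: conv => //; apply: convex_set_segment => //.
by move: c01; rewrite in_itv/= => /andP[/ltW -> /ltW ->].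
Qed.

(* The Cameron-Martin ball of radius [sqrt K] about [mstar], written as an
   intersection of closed half-spaces so that it is Borel in [H]. *)
Definition cm_cball (K : R) : set H :=
  [set x | forall h, ip (x - mstar) h ^+ 2 <= K * `|S h| ^+ 2].

Lemma closed_cm_cball K : closed (cm_cball K).
Proof.
rewrite (_ : cm_cball K = \bigcap_h [set x | ip (x - mstar) h ^+ 2 <= K * `|S h| ^+ 2]).
  apply: closed_bigI => h _.
  apply: (@closed_comp _ _ (fun x : H => ip (x - mstar) h ^+ 2) [set y | y <= K * `|S h| ^+ 2]);
    last exact: closed_le.
  move=> x _.
  have c1 : ip (y - mstar) h @[y --> x] --> ip (x - mstar) h.
    under eq_fun do rewrite ipDl.
    rewrite ipDl; apply: cvgD; last exact: cvg_cst.
    exact: (continuous_ipl hip).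
  exact: cvgM.
by apply/seteqP; split => [x xK h _|x xK h]; exact: xK.
Qed.

Lemma cm_cballP K x : cm x -> 0 <= K -> cm_cball K x <-> nrm (x - mstar) ^+ 2 <= K.
Proof.
move=> cx K0; rewrite (cm_norm_leP hip hS)//.
exact: cm_spaceB.
Qed.

(* [noise] is the pairing in the Cameron-Martin space of [x - mstar] with the
   random part [C0 (dPhi (y + x))] of [F]. *)
Definition noise K (x y : H) : R :=
  if x \in cm_cball K then ip (x - mstar) (dPhi (y + x)) else 0.

Definition sq_noise K (x y : H) : R :=
  if x \in cm_cball K then `|S (dPhi (y + x))| ^+ 2 else 0.

Lemma measurable_in_cm_cball K d (Om : measurableType d) (X : Om -> borel H) :
  measurable_fun setT X -> measurable_fun setT (fun t => (X t : H) \in cm_cball K).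
Proof.
move=> mX; apply: (measurable_fun_bool true).
rewrite setTI (_ : _ @^-1` _ = X @^-1` cm_cball K).
  by have := mX measurableT _ (closed_borel_measurable (@closed_cm_cball K)); rewrite setTI.
by apply/seteqP; split => t /=; [exact: set_mem|exact: mem_set].
Qed.

Section measurability.
Context d {Om : measurableType d} (X Y : Om -> borel H).
Hypotheses (mX : measurable_fun setT X) (mY : measurable_fun setT Y).

Let mD : measurable_fun setT (fun t => dPhi ((Y t : H) + (X t : H)) : borel H).
Proof. by apply: (measurableT_comp mdPhi); exact: measurable_borelD. Qed.

Lemma measurable_noise K : measurable_fun setT (fun t => noise K (X t) (Y t)).
Proof.
apply: measurable_fun_ifT => //; first exact: measurable_in_cm_cball.
apply: (measurable_ip hip hsep) => //.
exact: (measurable_borelD (g := cst (- mstar)) hsep mX).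
Qed.

Lemma measurable_sq_noise K : measurable_fun setT (fun t => sq_noise K (X t) (Y t)).
Proof.
apply: measurable_fun_ifT => //; first exact: measurable_in_cm_cball.
apply: measurable_funX; apply: measurable_borel_norm.
apply: (measurableT_comp (f := (S : borel H -> borel H))) => //.
by apply: continuous_borel_measurable; exact: sqrt_op_continuous hS.
Qed.

End measurability.

Hypothesis grad_bounded : forall B, cm_bounded ip S B -> exists M : R, forall m, B m ->
  (\int[nu0]_v (`|S (dPhi (m + (v : H)))| ^+ 2)%:E <= M%:E)%E.

Lemma sq_noise_mean_bounded K : 0 <= K ->
  exists2 M, 0 <= M & forall x, cm x -> (\int[nu0]_y (sq_noise K x y)%:E <= M%:E)%E.
Proof.
move=> K0.
have [|M hM] := @grad_bounded (cm `&` cm_cball K).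
  split; first by move=> x [].
  exists (Num.sqrt K + nrm mstar) => x [cx].
  move=> /(cm_cballP cx K0); rewrite -{1}(sqr_sqrtr K0) => xK.
  have {}xK : nrm (x - mstar) <= Num.sqrt K.
    by rewrite -(@ler_pXn2r _ 2)// ?nnegrE// ?sqrtr_ge0.
  rewrite -lerBlDr; apply: le_trans xK; rewrite !(cm_normE hip) (inv_sqrtB hip hS)//.
  exact: lerB_dist.
(* The maximum with 0 covers points outside the ball, where the noise vanishes. *)
exists (Num.max M 0) => [|x cx]; first by rewrite le_max lexx orbT.
have [xK|xK] := boolP (x \in cm_cball K).
  apply: (@le_trans _ _ M%:E); last by rewrite lee_fin le_max lexx.
  apply: le_trans (hM x _); last by split=> //; exact: set_mem.
  rewrite le_eqVlt; apply/orP; left; apply/eqP; apply: eq_integral => y _.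
  by rewrite /sq_noise xK addrC.
rewrite (eq_integral (cst 0%E)) ?integral0//; first by rewrite lee_fin le_max lexx orbT.
by move=> y _; rewrite /sq_noise (negbTE xK).
Qed.

(** The half-space inequality defining [cm_cball], taken at h = dPhi (y + x), is exactly this
    bound. *)
Lemma noise_sqr_le K x y : cm x -> 0 <= K -> noise K x y ^+ 2 <= K * sq_noise K x y.
Proof.
move=> cx K0; rewrite /noise /sq_noise; case: ifPn => xK; last by rewrite expr0n mulr0.
exact: set_mem xK _.
Qed.

Lemma noise_second_moment_bounded K : 0 <= K ->
  exists M, forall x, cm x -> (\int[nu0]_y (noise K x y ^+ 2)%:E <= M%:E)%E.
Proof.
move=> K0; have [M M0 hM] := sq_noise_mean_bounded K0; exists (K * M) => x cx.
have mid : measurable_fun setT (idfun : borel H -> borel H) by exact: measurable_id.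
have ms : measurable_fun setT (fun y : borel H => sq_noise K x y).
  exact: (measurable_sq_noise (X := cst x) (measurable_cst _) mid).
have mn : measurable_fun setT (fun y : borel H => noise K x y).
  exact: (measurable_noise (X := cst x) (measurable_cst _) mid).
apply: (@le_trans _ _ (\int[nu0]_y (K%:E * (sq_noise K x y)%:E))%E).
  apply: ge0_le_integral => //.
  - by move=> y _; rewrite lee_fin sqr_ge0.
  - by apply/measurable_EFinP; exact: measurable_funX.
  - by apply: measurable_funeM; exact/measurable_EFinP.
  - by move=> y _; rewrite -EFinM lee_fin noise_sqr_le.
rewrite ge0_integralZl_EFin//.
- by rewrite EFinM lee_wpmul2l ?lee_fin// hM.
- by move=> y _; rewrite lee_fin /sq_noise; case: ifP; rewrite ?sqr_ge0.
- exact/measurable_EFinP.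
Qed.

Lemma sqr_normD_le (x y : H) : `|x + y| ^+ 2 <= 2 * `|x| ^+ 2 + 2 * `|y| ^+ 2.
Proof.
rewrite -!(ip_norm hip); have := @ip_ge0 _ _ ip (x - y).
rewrite !ipE (ipC y x); lra.
Qed.

Lemma gradient_step_norm x y t : cm x ->
  nrm (x - t *: F C0 m0 dPhi x y - mstar) ^+ 2 =
  nrm (x - mstar) ^+ 2
  - 2 * t * (ip (x - mstar) (dPhi (y + x)) + cm_ip ip S (x - m0) (x - mstar))
  + t ^+ 2 * `|S (dPhi (y + x)) + T (x - m0)| ^+ 2.
Proof.
move=> cx; set g := dPhi (y + x).
have cxs : cm (x - mstar) by exact: cm_spaceB.
have cx0 : cm (x - m0) by exact: cm_spaceB.
have cF : cm (F C0 m0 dPhi x y) by apply: cm_spaceD => //; exact: (cm_space_sqr hS).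
have TF : T (F C0 m0 dPhi x y) = S g + T (x - m0).
  by rewrite /F [LHS](inv_sqrtD hip hS)//; [rewrite (inv_sqrt_sqr hip hS)|exact: (cm_space_sqr hS)].
rewrite -(ip_inv_sqrt hip hS)// /cm_ip !(cm_normE hip) addrAC.
rewrite (inv_sqrtB hip hS cxs (cm_spaceZ t cF)) (inv_sqrtZ hip hS)// TF -!(ip_norm hip) !ipE.
rewrite (ipC (S g) (T (x - mstar))) (ipC (T (x - m0)) (T (x - mstar))).
by rewrite (ipC (T (x - m0)) (S g)); ring.
Qed.

Section iterates.
Context d {Om : measurableType d} (P : probability Om R).
Variables (Grad : H -> H -> H) (a : nat -> R) (U0 : set H) (trunc : nat -> set H).
Variables (v X : nat -> Om -> H) (sigma : nat -> Om -> nat) (restart : nat -> Om -> H).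
Hypothesis rm : truncated_RM P S nu0 Grad a U0 trunc v X sigma restart.
Hypothesis Xcm : forall n w, cm (X n w).
Hypothesis a2 : cvgn (series (fun n => a n ^+ 2)).

Let G n : set (set Om) := [set E | exists2 B : set (borel H), measurable B &
  E = X 0%N @^-1` B \/ exists2 i, (i < n)%N & E = v i @^-1` B].

Let mX0 : measurable_fun setT (X 0%N : Om -> borel H).
Proof. by case: rm => -[]. Qed.

Let mv n : measurable_fun setT (v n : Om -> borel H).
Proof. by case: rm => -[]. Qed.

Let GP n : <<s G n >> `<=` measurable.
Proof.
apply: smallest_sub; first exact: sigma_algebra_measurable.
by move=> _ [B mB [->|[i _ ->]]]; rewrite -[X in measurable X]setTI; [exact: mX0|exact: mv].
Qed.

Let Gmono n : <<s G n >> `<=` <<s G n.+1 >>.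
Proof.
apply: sub_smallest2r; first exact: smallest_sigma_algebra.
move=> _ [B mB [->|[i ni ->]]]; exists B => //; first by left.
by right; exists i => //; exact: ltnW.
Qed.

Let mvG n : measurable_fun setT (v n : g_sigma_algebraType (G n.+1) -> borel H).
Proof.
move=> _ B mB; rewrite setTI; apply: sub_sigma_algebra.
by exists B => //; right; exists n.
Qed.

Let mXG n : measurable_fun setT (X n : g_sigma_algebraType (G n) -> borel H).
Proof. by move=> _ B mB; rewrite setTI; case: rm => _ _ _ _; exact. Qed.

Let indep n A (B : set (borel H)) : <<s G n >> A -> measurable B ->
  P (A `&` v n @^-1` B) = (P A * nu0 B)%E.
Proof.
move=> GA mB; case: rm => _ [vlaw ind] _ _ _.
rewrite -(vlaw n B mB).
(* In the independent sequence [X 0] has index 0 and [v n] has index n + 1, so the past consists of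
   n + 1 variables. *)
apply: (@independent_past _ _ _ _ P _ _ ind n.+1) => //.
  by case=> [|k]; [exact: mX0|exact: mv].
move: A GA; apply: sub_smallest2r; first exact: smallest_sigma_algebra.
move=> _ [C mC [->|[i ni ->]]]; exists C => //; first by exists 0%N.
by exists i.+1.
Qed.

Let mX_fst n : measurable_fun setT
  (fun z : g_sigma_algebraType (G n) * borel H => X n z.1 : borel H).
Proof. exact: (measurableT_comp (@mXG n) measurable_fst). Qed.

Lemma centered_gradient_noise_cvg_ae K : 0 <= K ->
  {ae P, forall w, cvgn (series (fun n => a n *
    (noise K (X n w) (v n w) - \int[nu0]_y noise K (X n w) y)))}.
Proof.
move=> K0; have [M hM] := noise_second_moment_bounded K0.
have mh n : measurable_fun setT (fun z : g_sigma_algebraType (G n) * borel H =>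
    noise K (X n z.1) z.2).
  exact: (measurable_noise (@mX_fst n) measurable_snd).
exact: (@centered_noise_series_cvg_ae _ _ _ P _ _ nu0 G (@GP) (@Gmono) v (@mvG) (@indep)
  (fun n w y => noise K (X n w) y) mh a M (fun n w => hM _ (Xcm n w)) a2).
Qed.

Lemma sq_gradient_noise_cvg_ae K : 0 <= K ->
  {ae P, forall w, cvgn (series (fun n => a n ^+ 2 * sq_noise K (X n w) (v n w)))}.
Proof.
move=> K0; have [M M0 hM] := sq_noise_mean_bounded K0.
have mh n : measurable_fun setT (fun z : g_sigma_algebraType (G n) * borel H =>
    sq_noise K (X n z.1) z.2).
  exact: (measurable_sq_noise (@mX_fst n) measurable_snd).
apply: (@nonneg_noise_series_cvg_ae _ _ _ P _ _ nu0 G (@GP) (@Gmono) v (@mvG) (@indep)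
  (fun n w y => sq_noise K (X n w) y) mh (fun n => a n ^+ 2) M _ (fun n w => hM _ (Xcm n w)) _ a2).
- by move=> n w y; rewrite /sq_noise; case: ifP; rewrite ?sqr_ge0.
- by move=> n; exact: sqr_ge0.
Qed.

(* Partial sums of [- 2 a_k xi_k + a_k^2 (2 |S Phi'|^2 + 4 K + 4 |mstar - m0|^2)],
   with [xi_k] the centered noise: the last factor dominates [|F|^2] when the
   squared distance to [mstar] is at most [K]. *)
Definition perturbation K w n : R :=
  - 2 * series (fun k => a k *
      (noise K (X k w) (v k w) - \int[nu0]_y noise K (X k w) y)) n
  + 2 * series (fun k => a k ^+ 2 * sq_noise K (X k w) (v k w)) n
  + (4 * K + 4 * nrm (mstar - m0) ^+ 2) * series (fun k => a k ^+ 2) n.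

Lemma perturbation_cvg_ae :
  {ae P, forall w, forall k : nat, cvgn (perturbation k%:R w)}.
Proof.
have h (k : nat) : {ae P, forall w, cvgn (perturbation k%:R w)}.
  have := centered_gradient_noise_cvg_ae (ler0n R k).
  apply: filterS2 (sq_gradient_noise_cvg_ae (ler0n R k)) => w c1 c2.
  by apply: is_cvgD; [apply: is_cvgD|]; apply: is_cvgMr.
apply: negligibleS (negligible_bigcup h) => w /= /existsNP[k nk].
by exists k.
Qed.

Local Notation D n w := (nrm (X n w - mstar) ^+ 2).
Local Notation step n w := (X n w - a n *: F C0 m0 dPhi (X n w) (v n w)).

(** The mean of [noise] is the integral in [J'], so the linear term of [gradient_step_norm] is [J']
    plus centered noise. Monotonicity bounds the former, and an increment of [perturbation] absorbs
    the rest. *)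
Lemma step_le (K alpha : R) n w : 0 < a n -> D n w <= K ->
  alpha * D n w <= J' ip S nu0 m0 dPhi (X n w) (X n w - mstar) ->
  nrm (step n w - mstar) ^+ 2 <=
    D n w - 2 * alpha * a n * D n w + (perturbation K w n.+1 - perturbation K w n).
Proof.
move=> an DK mono; have K0 : 0 <= K by apply: le_trans DK; exact: sqr_ge0.
have xK : X n w \in cm_cball K by apply: mem_set; apply/cm_cballP.
have nE : noise K (X n w) (v n w) = ip (X n w - mstar) (dPhi (v n w + X n w)).
  by rewrite /noise xK.
have sE : sq_noise K (X n w) (v n w) = `|S (dPhi (v n w + X n w))| ^+ 2.
  by rewrite /sq_noise xK.
have qE : \int[nu0]_y noise K (X n w) y =
    \int[nu0]_y ip (dPhi ((y : H) + X n w)) (X n w - mstar).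
  by apply: eq_Rintegral => y _; rewrite /noise xK ipC.
rewrite gradient_step_norm// /perturbation !seriesSr nE sE qE.
move: mono; rewrite /J'.
have := sqr_normD_le (S (dPhi (v n w + X n w))) (T (X n w - m0)).
(* Splitting at [mstar] gives factors 2, doubled again by the preceding inequality: this is the
   origin of the 4's in [perturbation]. *)
have : `|T (X n w - m0)| ^+ 2 <= 2 * K + 2 * nrm (mstar - m0) ^+ 2.
  have -> : X n w - m0 = (X n w - mstar) + (mstar - m0) by rewrite addrA subrK.
  rewrite (inv_sqrtD hip hS); [|exact: cm_spaceB|exact: cm_spaceB].
  apply: le_trans (sqr_normD_le _ _) _; move: DK; rewrite !(cm_normE hip); lra.
move: (`|T _| ^+ 2) (`|_ + _| ^+ 2) (`|S _| ^+ 2) (cm_ip _ _ _ _) (ip _ _) => t2 s2 g2 c p.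
move: (\int[nu0]_y _) (nrm (mstar - m0) ^+ 2) (D n w) DK => q e Dn DK.
move: (series _ n) (series _ n) (series _ n) => W V A hT hS' hm.
have h1 := ler_wpM2l (ltW an) hm.
have h2 : a n ^+ 2 * s2 <= a n ^+ 2 * (2 * g2 + 4 * K + 4 * e).
  by apply: ler_wpM2l; [exact: sqr_ge0|lra].
lra.
Qed.

Lemma finitely_many_truncations (alpha : R) w (rho kappa : R) n0 : 0 < alpha ->
  (forall n, 0 < a n) -> (forall k : nat, cvgn (perturbation k%:R w)) ->
  (forall n, alpha * D n w <= J' ip S nu0 m0 dPhi (X n w) (X n w - mstar)) ->
  rho < kappa ->
  (forall n, trunc (sigma n w) (step n w) -> X n.+1 w = step n w) ->
  (forall n, ~ trunc (sigma n w) (step n w) -> D n.+1 w <= rho) ->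
  (forall n, (n0 <= n)%N -> ~ trunc (sigma n w) (step n w) ->
     kappa <= nrm (step n w - mstar) ^+ 2) ->
  exists N, forall n, (N <= n)%N -> trunc (sigma n w) (step n w).
Proof.
move=> al0 a0 cp mono rk Xstep Xreset far.
(* Convergence of [perturbation] is available at integer cutoffs only. *)
have [k kK] : exists k : nat, kappa <= k%:R.
  by exists (Num.bound `|kappa|); apply: le_trans (ler_norm _) (ltW (archi_boundP _)).
have pstep n : D n w <= kappa -> nrm (step n w - mstar) ^+ 2 <=
    D n w + (perturbation k%:R w n.+1 - perturbation k%:R w n).
  move=> Dk; apply: le_trans (step_le (a0 n) (le_trans Dk kK) (mono n)) _.
  rewrite lerD2r gerBl; apply: mulr_ge0; last exact: sqr_ge0.
  by rewrite ltW// !mulr_gt0.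
have [||N hN] := finitely_many_resets (n0 := n0) (D := fun n => D n w)
  (reset := fun n => ~ trunc (sigma n w) (step n w)) rk (cp k) Xreset.
- by move=> n Dk /contrapT tr; rewrite Xstep//; exact: pstep.
- by move=> n n0n Dk tr; apply: le_trans (far n n0n tr) (pstep n Dk).
by exists N => n /hN /contrapT.
Qed.

Lemma iterates_cvg (alpha : R) w (K : R) N : 0 < alpha ->
  (forall n, 0 < a n) -> series a @ \oo --> +oo ->
  (forall k : nat, cvgn (perturbation k%:R w)) ->
  (forall n, alpha * D n w <= J' ip S nu0 m0 dPhi (X n w) (X n w - mstar)) ->
  (forall n, (N <= n)%N -> X n.+1 w = step n w) ->
  (forall n, (N <= n)%N -> D n w <= K) ->
  (fun n => nrm (X n w - mstar)) @ \oo --> (0 : R).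
Proof.
move=> al0 a0 aoo cp mono Xstep DK.
have [k kK] : exists k : nat, K <= k%:R.
  by exists (Num.bound `|K|); apply: le_trans (ler_norm _) (ltW (archi_boundP _)).
have cD : (fun n => D n w) @ \oo --> (0 : R).
  apply: (@cvg_contracting_perturbed _ _ (perturbation k%:R w) a (2 * alpha) N) => //.
  - by rewrite mulr_gt0.
  - by move=> n; exact: sqr_ge0.
  - by move=> n Nn; rewrite Xstep//; apply: step_le => //; exact: le_trans (DK n Nn) kK.
rewrite (_ : (fun n => _) = Num.sqrt \o (fun n => D n w)); last first.
  by apply/funext => n /=; rewrite sqrtr_sqr ger0_norm// sqrtr_ge0.
rewrite -sqrtr0; apply: cvg_comp cD _; exact: sqrt_continuous.
Qed.

End iterates.

End stochastic_gradient.

Unset Implicit Arguments.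
Set Strict Implicit.

Theorem theorem3p1
  (R : realType)
  (* the separable Hilbert space, C_0, its square root, and the N(m, C_0) *)
  (H : completeNormedModType R) (ip : {dot H for idfun})
  (hip : norm_from_ip ip) (hsep : separable H)
  (C0 S : {linear H -> H}) (hS : is_sqrt_op ip C0 S)
  (N : H -> probability (borel H) R)
  (hN : forall m, is_gaussian ip m C0 (N m))
  (m0 : H) (hm0 : cm_space S m0)
  (* the Banach space X, embedded in H with full measure, and the target mu *)
  (X : completeNormedModType R) (iota : {linear X -> H})
  (hiota : injective iota)
  (hX : {ae N m0, forall u : H, range (iota : X -> H) u})
  (Phi : X -> R) (hPhi : continuous Phi)
  (Z : \bar R)
  (hZ : Z = (\int[N m0]_u (expR (- extend iota Phi u))%:E)%E)
  (hZ0 : (0 < Z)%E) (hZoo : (Z < +oo)%E)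
  (mu : probability (borel H) R) (hmu0 : mu `<< N m0)
  (hmu : {ae N m0, forall u, ('d (charge_of_finite_measure mu) '/d (N m0)) u =
            ((fine Z)^-1 * expR (- extend iota Phi u))%:E})
  (* Phi' and Phi'': Borel, defined N(m, C_0)-almost everywhere *)
  (dPhi : H -> H) (d2Phi : H -> {linear H -> H})
  (mdPhi : measurable_fun setT (dPhi : borel H -> borel H))
  (hdPhi : forall m, cm_space S m -> {ae N 0%R, forall v : H,
     is_gradient ip iota S Phi (v + m) (dPhi (v + m)) /\
     is_hessian ip iota S Phi dPhi (v + m) (d2Phi (v + m))})
  (J : H -> \bar R) (hJ : J = fun m => relative_entropy (N m) mu)
  (hJvar : variations_of ip S (N 0) m0 dPhi d2Phi J)
  (* (i) *)
  (h1 : exists m, [/\ cm_space S m, N m `<< N m0, N m0 `<< N m & N m `<< mu])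
  (* (ii) *)
  (h2 : forall u, cm_space S u ->
     is_gradient ip iota S Phi u (dPhi u) /\
     is_hessian ip iota S Phi dPhi u (d2Phi u))
  (* (iii) *)
  (mstar : H) (hmstar : cm_space S mstar)
  (h3min : exists2 r : R, 0 < r &
     forall m, cm_ball ip S mstar r m -> (J mstar <= J m)%E)
  (h3crit : forall h, cm_space S h -> J' ip S (N 0) m0 dPhi mstar h = 0)
  (* (iv) *)
  (h4 : forall B, cm_bounded ip S B -> exists M : R, forall m, B m ->
     (\int[N 0%R]_v (`|S (dPhi (m + (v : H)))| ^+ 2)%:E <= M%:E)%E)
  (* (v) *)
  (Ustar : set H) (hUstar : cm_nbhs ip S mstar Ustar)
  (hUconv : convex_set (Ustar : set (convex_lmodType H)))
  (alpha : R) (halpha : 0 < alpha)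
  (h5 : forall m u, Ustar m -> cm_space S u ->
     alpha * cm_norm ip S u ^+ 2 <= J'' ip S (N 0) d2Phi m u u)
  (* step sizes and the algorithm *)
  (a : nat -> R) (ha0 : forall n, 0 < a n)
  (ha1 : series a @ \oo --> +oo)
  (ha2 : cvgn (series (fun n => a n ^+ 2)))
  (d : measure_display) (Omega : measurableType d) (P : probability Omega R)
  (v : nat -> Omega -> H) (Xn : nat -> Omega -> H)
  (sigma : nat -> Omega -> nat) (restart : nat -> Omega -> H) :
  (Ustar = cm_space S ->
     forall r : nat -> R,
     expanding_trust_region ip P S (N 0) (F C0 m0 dPhi) a r v Xn sigma restart ->
     cm_converges_as ip P S Xn mstar)
  /\
  (Ustar <> cm_space S ->
     forall U0 U1 : set H,
     cm_bounded ip S U1 -> convex_set (U1 : set (convex_lmodType H)) ->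
     U1 `<=` Ustar -> U1 mstar -> U0 `<=` U1 ->
     (exists R0 R1 : R, [/\ R0 < R1, U0 `<=` cm_ball ip S mstar R0,
        cm_ball ip S mstar R0 `<=` cm_ball ip S mstar R1 &
        cm_ball ip S mstar R1 `<=` U1]) ->
     fixed_trust_region ip P S (N 0) (F C0 m0 dPhi) a U0 U1 v Xn sigma restart ->
     cm_converges_as ip P S Xn mstar).
Proof.
have [Ucm [rs rs0 rsU]] := hUstar.
have Us : Ustar mstar.
  apply: rsU; split => //.
  by rewrite subrr (cm_normE hip) -(subrr mstar) (inv_sqrtB hip hS)// subrr normr0.
have mono m : Ustar m ->
    alpha * cm_norm ip S (m - mstar) ^+ 2 <= J' ip S (N 0) m0 dPhi m (m - mstar).
  move=> Um; apply: (strongly_monotone_gradient hmstar (d2Phi := d2Phi) (U := Ustar)) => //.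
  by move=> x cx u w; have [_ _ _ _] := hJvar x cx; exact.
have cmF x y : cm_space S x -> cm_space S (F C0 m0 dPhi x y).
  by move=> cx; apply: cm_spaceD; [exact: (cm_space_sqr hS)|exact: cm_spaceB].
have cm_step x y t : cm_space S x -> cm_space S (x - t *: F C0 m0 dPhi x y).
  by move=> cx; apply: cm_spaceB => //; apply: cm_spaceZ; exact: cmF.
have nrm0 x : 0 <= cm_norm ip S x by rewrite /cm_norm sqrtr_ge0.
have sqr_mono (x y : R) : 0 <= x -> x <= y -> x ^+ 2 <= y ^+ 2 by move=> x0 xy; nra.
split=> [UE r|_ U0 U1 [U1cm [b U1b]] _ U1U U1s U01 [R0 [R1 [R01 U0R0 _ R1U1]]]].
- move=> [r0 rinc roo rm]; have [_ _ [X0U restartU] [_ dyn] _] := rm.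
  have Xcm n w : cm_space S (Xn n w).
    case: n => [|n]; first by have [] := X0U w.
    have [tr ntr] := dyn n w.
    have [/[dup] -[cst _] /tr[-> _]|/ntr[-> _]] := pselect (cm_ball ip S 0 (r (sigma n w))
      (Xn n w - a n *: F C0 m0 dPhi (Xn n w) (v n w))); first exact: cst.
    by have [] := restartU (sigma n w) w.
  have := perturbation_cvg_ae hip hsep hS m0 hmstar mdPhi h4 rm Xcm ha2.
  apply: filterS => w cp.
  have monoX n : alpha * cm_norm ip S (Xn n w - mstar) ^+ 2 <=
      J' ip S (N 0) m0 dPhi (Xn n w) (Xn n w - mstar).
    by apply: mono; rewrite UE; exact: Xcm.
  pose st n := Xn n w - a n *: F C0 m0 dPhi (Xn n w) (v n w).
  pose inside n := cm_ball ip S 0 (r (sigma n w)) (st n).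
  have cst n : cm_space S (st n) by exact: cm_step.
  have stepX n : inside n -> Xn n.+1 w = st n by move=> /((dyn n w).1)[].
  (* Restart points have norm below [r 0], so they lie within c of [mstar]; the gap up to c + 1 is
     arbitrary. *)
  pose c := r 0%N + cm_norm ip S mstar.
  have c0 : 0 <= c by rewrite addr_ge0// ltW.
  (* From [k0] on, a trial step outside the trust region is at distance at least c + 1 from
     [mstar]. *)
  have [k0 _ hk0] : \forall k \near \oo, c + 1 + cm_norm ip S mstar <= r k.
    by move/cvgryPge : roo; exact.
  have [M hM] : exists M, forall n, (M <= n)%N -> inside n.
    apply: contrapT => infinite.
    (* Infinitely many truncations push [sigma] past [k0], and then [finitely_many_truncations]
       contradicts them. *)
    have [|||n0 hn0] := @counter_unbounded (fun n => sigma n w) (fun n => ~ inside n) _ _ _ k0.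
    + by move=> n /((dyn n w).2)[].
    + by move=> n /contrapT /((dyn n w).1)[].
    + move=> M; apply: contrapT => none; apply: infinite; exists M => n Mn.
      by apply: contrapT => ni; apply: none; exists n.
    apply: infinite.
    apply: (finitely_many_truncations hip hS hm0 hmstar Xcm (alpha := alpha)
      (rho := c ^+ 2) (kappa := (c + 1) ^+ 2) (n0 := n0) (w := w) (sigma := sigma)
      (trunc := fun k => cm_ball ip S 0 (r k))) => //.
    + by nra.
    + move=> n /((dyn n w).2)[-> _]; apply: sqr_mono => //.
      have [cr rr] := restartU (sigma n w) w.
      apply: le_trans (cm_normB_le hip hS cr hmstar) _.
      by rewrite lerD2r; apply: ltW; rewrite -[restart _ _]subr0.
    + move=> n n0n out; apply: sqr_mono; first by rewrite addr_ge0.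
      rewrite leNgt; apply/negP => near; apply: out; split; first exact: cst.
      rewrite subr0 -[X in cm_norm _ _ X](subrK mstar).
      apply: le_lt_trans (cm_normD_le hip hS (cm_spaceB (cst n) hmstar) hmstar) _.
      by apply: lt_le_trans (hk0 _ (hn0 _ n0n)); rewrite ltrD2r.
  have sigmaE n : (M <= n)%N -> sigma n w = sigma M w.
    elim: n => [|n IH]; first by rewrite leqn0 => /eqP ->.
    rewrite leq_eqVlt => /orP[/eqP <-//|Mn].
    by have [_ ->] := (dyn n w).1 (hM n Mn); exact: IH.
  (* The start is [M.+1] because the bound on an iterate comes from the acceptance of the preceding
     trial step, in a trust region frozen from time [M] on. *)
  apply: (iterates_cvg hip hS hm0 hmstar Xcm (alpha := alpha) (N := M.+1)
    (K := (r (sigma M w) + cm_norm ip S mstar) ^+ 2)) => //.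
    by move=> n Mn; apply: stepX; apply: hM; exact: ltnW.
  case=> // n Mn; rewrite (stepX _ (hM n Mn)); apply: sqr_mono => //.
  apply: le_trans (cm_normB_le hip hS (cst n) hmstar) _; rewrite lerD2r ltW//.
  by have [_] := hM n Mn; rewrite subr0 sigmaE.
- move=> [_ _ _ rm]; have [_ _ [X0U restartU] [_ dyn] _] := rm.
  have XU1 n w : U1 (Xn n w).
    case: n => [|n]; first exact/U01/X0U.
    have [tr ntr] := dyn n w.
    have [/[dup] + /tr[-> _]|/ntr[-> _]] := pselect (U1
      (Xn n w - a n *: F C0 m0 dPhi (Xn n w) (v n w))); first by [].
    exact/U01/restartU.
  have Xcm n w : cm_space S (Xn n w) by exact: U1cm.
  have := perturbation_cvg_ae hip hsep hS m0 hmstar mdPhi h4 rm Xcm ha2.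
  apply: filterS => w cp.
  have monoX n : alpha * cm_norm ip S (Xn n w - mstar) ^+ 2 <=
      J' ip S (N 0) m0 dPhi (Xn n w) (Xn n w - mstar).
    by apply: mono; apply: U1U; exact: XU1.
  (* The initial point lies in the ball of radius [R0], so [R0] is positive and squaring preserves
     R0 < R1. *)
  have R00 : 0 < R0 by have [_] := U0R0 _ (X0U w); exact: le_lt_trans.
  have [M hM] : exists M, forall n, (M <= n)%N ->
      U1 (Xn n w - a n *: F C0 m0 dPhi (Xn n w) (v n w)).
    (* Restarts land within [R0] of [mstar] while rejected steps lie at distance at least [R1], at
       every time, hence [n0 := 0]. *)
    apply: (finitely_many_truncations hip hS hm0 hmstar Xcm (alpha := alpha)
      (rho := R0 ^+ 2) (kappa := R1 ^+ 2) (n0 := 0%N) (sigma := sigma)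
      (trunc := fun=> U1)) => //.
    + by nra.
    + by move=> n /((dyn n w).1)[].
    + move=> n /((dyn n w).2)[-> _]; apply: sqr_mono => //.
      by have [_ /ltW] := U0R0 _ (restartU (sigma n w) w).
    + move=> n _ out; apply: sqr_mono; first by rewrite ltW// (lt_trans R00).
      rewrite leNgt; apply/negP => near; apply: out; apply: R1U1; split=> //.
      exact: cm_step.
  apply: (iterates_cvg hip hS hm0 hmstar Xcm (alpha := alpha) (N := M)
    (K := (b + cm_norm ip S mstar) ^+ 2)) => //.
    by move=> n Mn; have [] := (dyn n w).1 (hM n Mn).
  move=> n _; apply: sqr_mono => //.
  by apply: le_trans (cm_normB_le hip hS (Xcm n w) hmstar) _; rewrite lerD2r U1b.
Qed.
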